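(* Let $p \equiv 7 \pmod 8$ be a prime such that the multiplicative order of $2$ modulo $p$ is $\frac{p-1}{2}$. Then there is no generalized bent function of type $[n,q] = [t_p, 2p]$. If moreover $2^{p-1} \not\equiv 1 \pmod{p^2}$, then for every integer $e \ge 1$ there is no generalized bent function of type $[n,q] = [t_p, 2p^e]$.
   Context: For an integer $q \ge 2$ let $\mathbb{Z}_q = \mathbb{Z}/q\mathbb{Z}$ and $\zeta_q = \exp(2\pi i/q)$. A function $f : \mathbb{Z}_q^n \to \mathbb{Z}_q$ is a generalized bent function (GBF) of type $[n,q]$ if $F(\lambda)\overline{F(\lambda)} = q^n$ for every $\lambda \in \mathbb{Z}_q^n$, where $F(\lambda) = \sum_{x \in \mathbb{Z}_q^n} \zeta_q^{f(x)} \zeta_q^{-x\cdot\lambda}$ and $x\cdot\lambda$ is the standard dot product. For a prime $p \equiv 7 \pmod 8$, the prime $2$ splits in $\mathbb{Q}(\sqrt{-p})$; $t_p$ denotes the smallest positive integer such that $\mathfrak{p}^{t_p}$ is principal, where $\mathfrak{p}$ is a prime ideal of the ring of integers of $\mathbb{Q}(\sqrt{-p})$ lying above $2$ (i.e. the order of $\mathfrak{p}$ in the class group; it does not depend on the choice of $\mathfrak{p}$). *)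

(* Defs.v *)
From HB Require Import structures.
From mathcomp Require Import all_boot all_order all_algebra all_field.
From mathcomp Require Import complex.
From mathcomp Require Import reals trigo.
Set Implicit Arguments. Unset Strict Implicit. Unset Printing Implicit Defensive.
Import Order.TTheory GRing.Theory Num.Theory.
Local Open Scope ring_scope.
Local Open Scope complex_scope.

Definition zeta (R : realType) (q : nat) : R[i] :=
  (cos (2 * pi / q%:R)) +i* (sin (2 * pi / q%:R)).

Definition dotZ (q n : nat) (x l : 'I_n -> 'Z_q) : 'Z_q :=
  \sum_(i < n) x i * l i.

Definition gbf_transform (R : realType) (q n : nat)
    (f : {ffun 'I_n -> 'Z_q} -> 'Z_q) (l : {ffun 'I_n -> 'Z_q}) : R[i] :=
  \sum_(x : {ffun 'I_n -> 'Z_q})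
     (zeta R q) ^+ (nat_of_ord (f x)) * ((zeta R q)^-1) ^+ (nat_of_ord (dotZ x l)).

(* f : Z_q^n -> Z_q is a GBF of type [n,q] (meaningful for q >= 2) *)
Definition is_gbf (R : realType) (n q : nat) (f : {ffun 'I_n -> 'Z_q} -> 'Z_q) : Prop :=
  forall l : {ffun 'I_n -> 'Z_q},
    gbf_transform R f l * (gbf_transform R f l)^* = (q ^ n)%N%:R.

(* ring of integers of Q(sqrt(-p)) for p = 3 mod 4: Z[omega], omega = (1+sqrt(-p))/2,
   realized inside algC *)
Definition omega (p : nat) : algC := (1 + sqrtC (- p%:R)) / 2.

Definition inO (p : nat) (x : algC) : Prop :=
  exists a b : int, x = a%:~R + b%:~R * omega p.

Definition is_ideal (p : nat) (I : algC -> Prop) : Prop :=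
  [/\ forall x, I x -> inO p x,
      I 0,
      forall x y, I x -> I y -> I (x + y)
    & forall r x, inO p r -> I x -> I (r * x)].

Definition ideal_mul (p : nat) (I J : algC -> Prop) : algC -> Prop :=
  fun x => forall K, is_ideal p K -> (forall a b, I a -> J b -> K (a * b)) -> K x.

Fixpoint ideal_pow (p : nat) (I : algC -> Prop) (t : nat) : algC -> Prop :=
  match t with
  | 0 => inO p
  | t'.+1 => ideal_mul p I (ideal_pow p I t')
  end.

Definition principal_ideal (p : nat) (I : algC -> Prop) : Prop :=
  exists a, inO p a /\ forall x, I x <-> exists r, inO p r /\ x = a * r.

Definition prime_ideal (p : nat) (P : algC -> Prop) : Prop :=
  [/\ is_ideal p P, ~ P 1
    & forall a b, inO p a -> inO p b -> P (a * b) -> P a \/ P b].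

Definition is_class_order (p : nat) (P : algC -> Prop) (t : nat) : Prop :=
  (0 < t)%N /\ principal_ideal p (ideal_pow p P t) /\
  forall s, (0 < s)%N -> principal_ideal p (ideal_pow p P s) -> (t <= s)%N.

Definition is_mul_order (a m k : nat) : Prop :=
  (0 < k)%N /\ a ^ k = 1 %[mod m] /\
  forall j, (0 < j)%N -> a ^ j = 1 %[mod m] -> (k <= j)%N.

(* Main.v *)
(* Let m = p^e, let z be a primitive m-th root of unity and q = 2m. The values F
   of the transform of a GBF lie in Z[z] and satisfy F F^* = 2^t m^t with t = t_p.
   Since 2 has order phi(m)/2 modulo m, the only primes of Z[z] above 2 are
   those generated by the two primes of the quadratic order O of Q(sqrt(-p)),
   and p is totally ramified. Hence the automorphism sg : z |-> z^2 fixes the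
   ideal (F), so that sg F / F is a unit of absolute value 1, i.e. +- a power
   of z; as sg z / z = z, some F / z^k is fixed by sg and lies in O. By
   minimality (and oddness) of t it is not divisible by 2, so F is divisible by
   the t-th power of one of the two primes above 2.
   Shifting the argument l of F by a vector v of {0, m}^t changes F by a multiple
   of 2, and by the above only by a sign. Therefore the sum over v of
   F(l + v), which is 2^t times the partial sum S(l) of the transform over the
   even x, is an integer multiple of F(l), and this integer is divisible
   by 2^t: S(l) = d(l) F(l) with d(l) an integer. Parseval's identity for S gives
   the odd value m^t for the sum of the d(l)^2, which is even because d(l)^2
   is invariant under the shift by (m, ..., m). *)

Require Import Defs.
From HB Require Import structures.
From mathcomp Require Import all_boot all_order all_algebra all_field.
From mathcomp Require Import boolp complex reals trigo ring lra zify.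
Set Implicit Arguments. Unset Strict Implicit. Unset Printing Implicit Defensive.
Import Order.TTheory GRing.Theory Num.Theory.

(** No ideal of Z[z] is ever formed. With [th = omega p] one has [th * (1 - th) = 2 * c], and
    divisibility of [x] by the [i]-th power of the prime (2, th) is written
    [(1 - th) ^+ i * x / 2 ^+ i \in A]. As [th] and [1 - th] have comaximal powers, divisibility by
    a power of 2 can be checked after multiplication by a power of each. Gauss periods place [th] in
    Z[z] and show that [sg] fixes it. Oddness of t expresses that the class of the prime above 2 has
    odd order; it comes from factoring B^2 - X^2 = p Y^2. The change of F under a shift is only a
    sign because a non-zero [1 - z ^+ k] divides the odd number m and so cannot absorb a factor 2.
    The condition modulo p^2 keeps the subgroup generated by 2 of index 2 modulo p^e for e > 1. The
    transform lives in [R[i]] while the arithmetic takes place in [algC]; the GBF equation is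
    polynomial over the integers in the root of unity, hence can be moved from one field to the
    other. *)

(** * Elementary arithmetic: coprime factors of squares, and the order of 2 modulo prime powers *)

(** Expanding the square of [gcdn a y] and replacing [y ^ 2] by [a * b] pulls out a factor [a]; the
    cofactor is the gcd of [a], [y] and [b], which is 1. *)
Lemma coprime_mul_square a b y : coprime a b -> a * b = y ^ 2 ->
  a = gcdn a y ^ 2.
Proof.
move=> cab aby; have cop : coprime (gcdn a y) (gcdn y b).
  by rewrite (coprime_dvdl (dvdn_gcdl _ _)) // (coprime_dvdr (dvdn_gcdr _ _)).
rewrite -mulnn {1}muln_gcdr !muln_gcdl [y * y]mulnn -aby (mulnC y a).
rewrite -!muln_gcdr.
rewrite -gcdnA (gcdnA y y) gcdnn gcdnA.
by move: cop; rewrite /coprime => /eqP; rewrite -gcdnA (gcdnA y y) gcdnn gcdnA => ->; rewrite muln1.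
Qed.

(** Dividing [p] out of the factor that contains it leaves two coprime factors of a square. Only sum
    and product are recorded, because it is unknown which factor contains [p]. *)
Lemma coprime_mul_prime_square p a b y : prime p -> coprime a b ->
  a * b = p * y ^ 2 ->
  exists u v, a + b = v ^ 2 + p * u ^ 2 /\ a * b = v ^ 2 * (p * u ^ 2).
Proof.
move=> pp; wlog pa : a b / p %| a.
  move=> W cab E; have : p %| a * b by rewrite E dvdn_mulr.
  rewrite Euclid_dvdM // => /orP [pa|pb]; first exact: W.
  rewrite addnC mulnC; apply: W => //; first by rewrite coprime_sym.
  by rewrite mulnC.
case/dvdnP: pa => a' -> cab E; have p0 := prime_gt0 pp.
have E' : a' * b = y ^ 2.
  by apply/eqP; rewrite -(eqn_pmul2l p0) -E; apply/eqP; ring.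
have cab' : coprime a' b by apply: coprime_dvdl cab; rewrite dvdn_mulr.
have aE := coprime_mul_square cab' E'.
have bE : b = gcdn b y ^ 2.
  by apply: (@coprime_mul_square _ a'); rewrite 1?coprime_sym // mulnC.
exists (gcdn a' y), (gcdn b y); rewrite -aE -bE; split; ring.
Qed.

(* A representation [X^2 + p Y^2 = B^2] with [B] a power of 2 factors as
   [(B - X) (B + X) = p Y^2] with coprime factors. *)
Lemma odd_repr_square_half p r X Y : prime p -> odd p -> odd X -> odd Y ->
  X ^ 2 + p * Y ^ 2 = (2 ^ r.+1) ^ 2 ->
  exists u v, [/\ odd u, odd v & v ^ 2 + p * u ^ 2 = 2 ^ r.+2].
Proof.
move=> pp op oX oY E; have p0 := prime_gt0 pp; set B := 2 ^ r.+1 in E.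
have oB : ~~ odd B by rewrite /B oddX.
have XB : X < B.
  rewrite -(ltn_exp2r _ _ (isT : 0 < 2)) -E -[X in X < _]addn0 ltn_add2l.
  by rewrite muln_gt0 p0 expn_gt0; case: Y oY {E}.
have UV : (B - X) * (B + X) = p * Y ^ 2 by rewrite -subn_sqr -E addKn.
have oU : odd (B - X) by rewrite oddB ?(ltnW XB) // oX (negPf oB).
have sE : B - X + (B + X) = 2 ^ r.+2.
  by rewrite addnA addnAC subnK ?(ltnW XB) // expnS -/B; lia.
have cop : coprime (B - X) (B + X).
  by rewrite /coprime -gcdnDl sE -/(coprime _ _) coprimeXr // coprimen2.
have [u [v [S M]]] := coprime_mul_prime_square pp cop UV.
exists u, v; rewrite -S sE; split=> //.
  move: (congr1 odd M); rewrite UV !oddM op oY /=.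
  by case: (odd u); case: (odd v).
move: (congr1 odd M); rewrite UV !oddM op oY /=.
by case: (odd u); case: (odd v).
Qed.

Lemma even_intP (a : int) : ~~ odd `|a| -> exists h : int, a = (2 * h)%R.
Proof. by exists (a %/ 2)%Z; have := divz_eq a 2; lia. Qed.

Lemma odd_diff_even (u v : nat) : odd u -> odd v ->
  exists h : int, (v%:Z - u%:Z = 2 * h)%R.
Proof. by move=> ou ov; apply: even_intP; lia. Qed.

Lemma mul_order_dvd a m k j : is_mul_order a m k -> a ^ j = 1 %[mod m] -> k %| j.
Proof.
move=> [k0 [ak kmin]] aj; rewrite /dvdn; apply: contraT; rewrite -lt0n => j0.
have := ltn_pmod j k0; rewrite ltnNge kmin //.
have aE : a ^ j = (a ^ k) ^ (j %/ k) * a ^ (j %% k).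
  by rewrite -expnM -expnD mulnC -divn_eq.
by move: aj; rewrite aE -modnMml -modnXm ak modnXm exp1n modnMml mul1n.
Qed.

Lemma exp1D_mod3 x n :
  exists r, (1 + x) ^ n = 1 + n * x + 'C(n, 2) * x ^ 2 + x ^ 3 * r.
Proof.
elim: n => [|n [r IH]]; first by exists 0; rewrite bin0n; lia.
exists ('C(n, 2) + r + r * x); rewrite expnSr IH binS bin1; ring.
Qed.

(** Each [p]-th power adds one to the exponent of [p] in the distance to 1: the linear binomial term
    does this, and the quadratic one is of higher order because the odd prime [p] divides
    ['C(p, 2)]. The congruence on [c'] shows that the exponent stays exact when [p] does not divide
    [c]. *)
Lemma exp_lift p c v : prime p -> 2 < p ->
  exists c', (1 + p * c) ^ (p ^ v) = 1 + p ^ v.+1 * c' /\ c' = c %[mod p].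
Proof.
move=> pp p2; elim: v => [|v [c' [IH cc']]]; first by exists c; rewrite expn1.
rewrite expnSr expnM IH; have [r ->] := exp1D_mod3 (p ^ v.+1 * c') p.
have /dvdnP [h ->] : p %| 'C(p, 2) by rewrite prime_dvd_bin //.
exists (c' + p * (p ^ v * c' ^ 2 * h + p ^ v * p ^ v * c' ^ 3 * r)); split.
  rewrite !expnS; ring.
by rewrite addnC mulnC modnMDl.
Qed.

(** The condition modulo [p ^ 2] says that [p] divides [2 ^ f - 1] exactly once. Then the exponent
    of [p] in [2 ^ (f * i) - 1] is one more than in [i], so reaching [p ^ e] requires [p ^ e.-1] to
    divide [i]. *)
Lemma order2_ppow p f e : prime p -> 2 < p -> is_mul_order 2 p f -> 0 < e ->
  e = 1 \/ 2 ^ (f * 2) <> 1 %[mod p ^ 2] ->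
  2 ^ (p ^ e.-1 * f) = 1 %[mod p ^ e] /\
  forall j, 2 ^ j = 1 %[mod p ^ e] -> p ^ e.-1 * f %| j.
Proof.
move=> pp p2 ord e0 H; have p0 := prime_gt0 pp; have [f0 [f1 fmin]] := ord.
have [c cE] : exists c, 2 ^ f = 1 + p * c.
  have : p %| 2 ^ f - 1 by rewrite -eqn_mod_dvd ?expn_gt0 //; apply/eqP.
  case/dvdnP => c cE; exists c; rewrite mulnC -cE subnKC // expn_gt0 //.
split.
  have [c' [c'E _]] := exp_lift c e.-1 pp p2.
  by rewrite mulnC expnM cE c'E prednK // addnC mulnC modnMDl.
move=> j jE.
have /(mul_order_dvd ord) /dvdnP [i ij] : 2 ^ j = 1 %[mod p].
  have := congr1 (modn^~ p) jE; rewrite !modn_dvdm //;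
  by rewrite -{1}(expn1 p) dvdn_exp2l.
case: H => [-> |nw]; first by rewrite mul1n ij dvdn_mull.
have pc : ~~ (p %| c).
  apply/negP => /dvdnP [d dE]; apply: nw; rewrite expnM cE dE.
  have -> : (1 + p * (d * p)) ^ 2 = (2 * d + d * d * p ^ 2) * p ^ 2 + 1.
    ring.
  by rewrite modnMDl.
rewrite ij; have [->|i0] := posnP i; first by rewrite mul0n dvdn0.
have [i' ci' iE] := pfactor_coprime pp i0; set v := logn p i in iE.
rewrite dvdn_mul // iE dvdn_mull // dvdn_exp2l //.
rewrite leqNgt; apply/negP => ltv.
have [c' [c'E cc]] := exp_lift c v pp p2.
have pc' : ~~ (p %| c') by rewrite /dvdn cc.
have jv : 2 ^ j = (1 + p ^ v.+1 * c') ^ i'.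
  by rewrite -c'E -cE -!expnM ij iE; congr (2 ^ _); ring.
have [r rE] := exp1D_mod3 (p ^ v.+1 * c') i'.
have : p ^ v.+2 %| 2 ^ j - 1.
  apply: (@dvdn_trans (p ^ e)).
    by rewrite dvdn_exp2l // -(prednK e0).
  by rewrite -eqn_mod_dvd ?expn_gt0 //; apply/eqP.
have -> : 2 ^ j - 1 = p ^ v.+1 * (i' * c' +
    p * (p ^ v * ('C(i', 2) * c' ^ 2 + p ^ v.+1 * c' ^ 3 * r))).
  rewrite jv rE; rewrite -2!addnA addKn !expnS; ring.
rewrite expnSr dvdn_pmul2l ?expn_gt0 ?p0 // (dvdn_addl _ (dvdn_mulr _ (dvdnn p))).
by rewrite Euclid_dvdM // (negPf pc') orbF; apply/negP; rewrite -prime_coprime.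
Qed.

Local Open Scope ring_scope.

(** * Roots of unity and the passage between fields *)

Lemma conj_unity_root (C : numClosedFieldType) n (z : C) :
  (0 < n)%N -> z ^+ n = 1 -> z^* = z^-1.
Proof.
move=> n0 zn; have nz1 : `|z| = 1.
  by apply/eqP; rewrite -(pexpr_eq1 n0) // -normrX zn normr1.
by rewrite invC_norm nz1 expr1n invr1 mul1r.
Qed.

Lemma zetaX (R : realType) q k :
  zeta R q ^+ k = (cos ((2 * pi / q%:R) *+ k) +i* sin ((2 * pi / q%:R) *+ k))%C.
Proof.
elim: k => [|k IH]; first by rewrite expr0 mulr0n cos0 sin0.
rewrite exprS IH /zeta [_ *+ k.+1]mulrS cosD sinD; apply/eqP.
by rewrite eq_complex /= eqxx /= addrC (mulrC (cos _)) addrC.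
Qed.

Lemma zeta_prim (R : realType) q : (1 < q)%N -> q.-primitive_root (zeta R q).
Proof.
move=> q1; have q0 : (0 < q)%N by apply: leq_trans q1.
have qR : (0 : R) < q%:R by rewrite ltr0n.
have zq : zeta R q ^+ q = 1.
  rewrite zetaX -mulr_natr mulfVK ?gt_eqF // mulr_natl cos2pi sin2pi.
  by apply/eqP; rewrite eq_complex /= !eqxx.
apply/andP; split => //; apply/forallP => i; rewrite unity_rootE.
case: (i.+1 =P q) => [->|/eqP ne]; first by rewrite zq eqxx.
have lt : (i.+1 < q)%N by rewrite ltn_neqAle ne ltn_ord.
rewrite eqbF_neg zetaX; apply/negP; rewrite eq_complex /= => /andP [/eqP c1 _].
set k := i.+1 in lt c1.
(* Half the angle of [zeta ^+ k]: a real part 1 forces [sin x = 0], impossible as [x] lies strictly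
   between 0 and [pi]. *)
pose x : R := pi * k%:R / q%:R.
have xE : (2 * pi / q%:R) *+ k = x + x :> R.
  by rewrite /x -mulr_natr; field; rewrite gt_eqF.
move: c1; rewrite xE cosD -!expr2 => c1.
have s0 : sin x = 0.
  by apply/eqP; rewrite -sqrf_eq0; have := cos2Dsin2 x => cs; apply/eqP; lra.
suff: 0 < sin x by rewrite s0 ltxx.
apply: sin_gt0_pi; rewrite /x divr_gt0 ?mulr_gt0 ?pi_gt0 ?ltr0n //=.
by rewrite ltr_pdivrMr // ltr_pM2l ?pi_gt0 // ltr_nat.
Qed.

(** The product of the ['Phi_d] over [d] dividing [n] is ['X^n - 1], so some ['Phi_d] vanishes at
    [z]; then [z ^+ d = 1], and primitivity gives [d = n]. *)
Lemma root_Cyclotomic_char0 (F : fieldType) n (z : F) :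
  n.-primitive_root z -> root (map_poly intr 'Phi_n) z.
Proof.
move=> zn; have n0 := prim_order_gt0 zn.
have : root (map_poly intr (\prod_(d <- divisors n) 'Phi_d)) z.
  rewrite prod_Cyclotomic // rmorphB rmorph1 /= map_polyXn.
  by rewrite rootE !hornerE prim_expr_order // subrr.
rewrite rmorph_prod rootE horner_prod prodf_seq_eq0 => /hasP [d dn /= zd].
move: dn; rewrite -dvdn_divisors // => dn.
have d0 : (0 < d)%N := dvdn_gt0 n0 dn.
suff nd : (n %| d)%N.
  by have /eqP -> : n == d by rewrite eqn_dvd nd dn.
rewrite (prim_order_dvd zn) -subr_eq0.
have : root (map_poly intr (\prod_(d' <- divisors d) 'Phi_d')) z.
  rewrite rmorph_prod rootE horner_prod prodf_seq_eq0; apply/hasP.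
  by exists d => //; rewrite -dvdn_divisors.
rewrite prod_Cyclotomic // rmorphB rmorph1 /= map_polyXn.
by rewrite rootE !hornerE.
Qed.

(* 'Phi_n is irreducible over the rationals, so all primitive n-th roots of
   unity in all fields of characteristic 0 satisfy the same equations. *)
Lemma prim_root_transfer (F : numFieldType) n (z : F) (w : algC)
    (P : {poly int}) :
  n.-primitive_root z -> n.-primitive_root w ->
  root (map_poly intr P) z -> root (map_poly intr P) w.
Proof.
move=> zn wn Pz; have [r [rE r_mon] rP] := minCpolyP w.
have ZR (G : numFieldType) (Q : {poly int}) :
    map_poly intr Q = map_poly ratr (map_poly intr Q : {poly rat}) :> {poly G}.
  by rewrite -map_poly_comp /=; apply: eq_map_poly => a /=; rewrite ratr_int.
have rPhi : r = map_poly intr 'Phi_n.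
  apply: (map_inj_poly (fmorph_inj (ratr : rat -> algC)) (rmorph0 _)).
  by rewrite -rE (minCpoly_cyclotomic wn) -ZR (Cintr_Cyclotomic wn).
have rz : root (map_poly ratr r) z.
  by rewrite rPhi -ZR root_Cyclotomic_char0.
rewrite ZR rP; set PQ := map_poly _ P.
have r_irr : irreducible_poly r.
  split => [|q sq qr].
    by rewrite -(size_map_poly (ratr : {rmorphism rat -> algC})) -rE size_minCpoly.
  have [q' q'E] := dvdpP _ _ qr.
  have : root (map_poly ratr (q' * q)) w by rewrite -q'E -rE root_minCpoly.
  rewrite rmorphM /= rootM !rP => /orP [] rq; last first.
    by rewrite /eqp qr.
  have r0 : r != 0 by rewrite monic_neq0.
  have q'0 : q' != 0 by apply: contraNneq r0 => q'0; rewrite q'E q'0 mul0r.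
  have q0 : q != 0 by apply: contraNneq r0 => q0; rewrite q'E q0 mulr0.
  have := dvdp_leq q'0 rq; rewrite q'E size_mul // => le.
  move: sq; have : (0 < size q')%N by rewrite size_poly_gt0.
  have : (0 < size q)%N by rewrite size_poly_gt0.
  by case: (size q) le => [|[|k]] //; lia.
(* Otherwise the irreducible [r] is coprime to the polynomial [PQ], and a Bezout relation evaluated
   at the common root [z] reads 0 = 1. *)
apply: contraT => nrP.
have /Bezout_eq1_coprimepP [[u v] /= uv] : coprimep r PQ.
  by rewrite irreducible_poly_coprime // nrP.
have : (map_poly ratr (u * r + v * PQ)).[z] = 0.
  rewrite rmorphD !rmorphM /= !hornerE (rootP rz) -ZR (rootP Pz).
  by rewrite !mulr0 addr0.
by rewrite uv rmorph1 hornerE => /eqP; rewrite oner_eq0.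
Qed.

(** * The rings Z[z] *)

(** A boolean predicate, by classical decision, so that the closure lemmas [rpredD], [rpredM], ...
    apply. Divisibility of [x] by [n] in Z[z] is expressed throughout as [x / n \in Zadj z]. *)
Definition Zadj (z : algC) : {pred algC} :=
  fun x => `[< exists P : {poly int}, x = (map_poly intr P).[z] >].

Lemma ZadjP z x :
  reflect (exists P : {poly int}, x = (map_poly intr P).[z]) (x \in Zadj z).
Proof. exact: asboolP. Qed.

Lemma Zadj_subring z : subring_closed (Zadj z).
Proof.
split; first by apply/ZadjP; exists 1; rewrite rmorph1 hornerE.
  move=> x y /ZadjP [P ->] /ZadjP [Q ->]; apply/ZadjP; exists (P - Q).
  by rewrite rmorphB !hornerE.
move=> x y /ZadjP [P ->] /ZadjP [Q ->]; apply/ZadjP; exists (P * Q).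
by rewrite rmorphM !hornerE.
Qed.

HB.instance Definition _ z := GRing.isSubringClosed.Build algC (Zadj z)
  (Zadj_subring z).

Lemma mem_Zadj z : z \in Zadj z.
Proof. by apply/ZadjP; exists 'X; rewrite map_polyX hornerX. Qed.

Lemma Zadj_ind (S : {pred algC}) z : subring_closed S -> z \in S ->
  {subset Zadj z <= S}.
Proof.
move=> [S1 SB SM] Sz x /ZadjP [P ->].
have S0 : 0 \in S by rewrite -(subrr 1) SB.
have SN a : a \in S -> - a \in S by move=> ?; rewrite -sub0r SB.
have SD a b : a \in S -> b \in S -> a + b \in S.
  by move=> ? ?; rewrite -[b]opprK SB // SN.
elim/poly_ind: P => [|P c IH]; first by rewrite rmorph0 horner0.
rewrite rmorphD rmorphM /= map_polyX map_polyC !hornerE SD ?SM //.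
have Sn n : n%:R \in S by elim: n => // n IHn; rewrite mulrS SD.
by case: c => n; rewrite ?NegzE ?rmorphN ?SN //; exact: Sn.
Qed.

Lemma Zadj_sub y z : z \in Zadj y -> {subset Zadj z <= Zadj y}.
Proof. exact/Zadj_ind/Zadj_subring. Qed.

Lemma Zadj_Aint z : z \in Aint -> {subset Zadj z <= Aint}.
Proof. exact/Zadj_ind/Aint_subring. Qed.

Lemma Zadj_int z x : z \in Aint -> x \in Zadj z -> x \in Crat -> x \in Num.int.
Proof. by move=> zA /(Zadj_Aint zA) xA xQ; apply: Cint_rat_Aint. Qed.

Lemma Zadj_rmorph (u : {rmorphism algC -> algC}) z x :
  u z \in Zadj z -> x \in Zadj z -> u x \in Zadj z.
Proof.
move=> uz; apply: (@Zadj_ind [pred y | u y \in Zadj z]) => //.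
by split => [|a b|a b]; rewrite !inE ?rmorph1 ?rmorphB ?rmorphM ?rpred1 //;
   [exact: rpredB | exact: rpredM].
Qed.

Lemma Zadj_half z : z \in Aint -> 2^-1 \notin Zadj z.
Proof.
move=> zA; apply/negP => /(Zadj_int zA); rewrite rpredV rpred_nat => /(_ isT).
move/intrP => [k kE].
have : (k * 2)%:~R = 1 :> algC by rewrite rmorphM /= -kE mulVf ?pnatr_eq0.
by move/eqP; rewrite -[1]/(1%:~R) eqr_int => /eqP; lia.
Qed.

Lemma Zadj_comax z th k l : th \in Zadj z ->
  exists a b, [/\ a \in Zadj z, b \in Zadj z & a * th ^+ k + b * (1 - th) ^+ l = 1].
Proof.
move=> thz.
have [a0 [b0 [a0z b0z ab0]]] : exists a b,
    [/\ a \in Zadj z, b \in Zadj z & a * th ^+ k + b * (1 - th) = 1].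
  elim: k => [|k [a [b [az bz ab]]]].
    by exists 1, 0; rewrite rpred0 rpred1; split=> //; ring.
  exists a, (a * th ^+ k + b).
  rewrite az rpredD ?rpredM ?rpredX //; split => //.
  by rewrite -[RHS]ab exprS; ring.
elim: l => [|l [a [b [az bz ab]]]].
  by exists 0, 1; rewrite rpred0 rpred1; split=> //; ring.
have lz : (1 - th) ^+ l \in Zadj z by rewrite rpredX ?rpredB ?rpred1.
exists (a + b * (1 - th) ^+ l * a0), (b * b0).
rewrite rpredD ?rpredM //; split=> //.
transitivity (a * th ^+ k + b * (1 - th) ^+ l * (a0 * th ^+ k + b0 * (1 - th))).
  by rewrite exprS; ring.
by rewrite ab0 mulr1.
Qed.

(** Since [th + (1 - th) = 1], powers of the two are comaximal. This gives a local test of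
    divisibility: with [n] a power of 2, the two premises treat the two primes above 2
    separately. *)
Lemma Zadj_comax_div z th k l x n : th \in Zadj z ->
  th ^+ k * x / n \in Zadj z -> (1 - th) ^+ l * x / n \in Zadj z ->
  x / n \in Zadj z.
Proof.
move=> thz; have [a [b [az bz ab]]] := Zadj_comax k l thz => A B.
rewrite -[x]mul1r -ab.
have -> : (a * th ^+ k + b * (1 - th) ^+ l) * x / n =
   a * (th ^+ k * x / n) + b * ((1 - th) ^+ l * x / n) by ring.
by apply: rpredD; apply: rpredM.
Qed.

(** * The quadratic order and the class of the prime above 2 *)

Lemma sqrtC_opp_conj (n : nat) : (sqrtC (- n%:R : algC))^* = - sqrtC (- n%:R).
Proof.
set s := sqrtC _; have s2 : s ^+ 2 = - n%:R by rewrite sqrtCK.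
have [->|s0] := eqVneq s 0; first by rewrite rmorph0 oppr0.
apply: (mulfI s0); rewrite mulrN -expr2 s2 opprK -normCK -normrX s2 normrN.
by rewrite ger0_norm ?ler0n.
Qed.

Lemma omega_conj p : (omega p)^* = 1 - omega p.
Proof.
rewrite /omega rmorphM rmorphD rmorph1 fmorphV rmorph_nat /= sqrtC_opp_conj.
by field.
Qed.

(** The norm of [omega p] is (p + 1) / 4, which is even for p = 7 modulo 8; this is the splitting of
    2. *)
Lemma omega_conj_mul p c : p.+1 = (8 * c)%N ->
  omega p * (1 - omega p) = 2 * c%:R.
Proof.
move=> pE; rewrite /omega; set s := sqrtC _.
have s2 : s ^+ 2 = 1 - 8 * c%:R.
  rewrite sqrtCK -natrM -pE -natr1; ring.
transitivity ((1 - s ^+ 2) / 4); first by field.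
by rewrite s2; field.
Qed.

Section QuadraticOrder.

(* These equations of [omega p] are all that is used until [thE]. *)
Variables (p c : nat) (th : algC).
Hypotheses (pE : p.+1 = (8 * c)%N) (th_conj : th^* = 1 - th).
Hypothesis th_mul : th * (1 - th) = 2 * c%:R.

Local Notation A := (Zadj th).

Lemma delta_sq : (2 * th - 1) ^+ 2 = - p%:R.
Proof.
have -> : (2 * th - 1) ^+ 2 = 1 - 4 * (th * (1 - th)) by ring.
have -> : p%:R = 8 * c%:R - 1 :> algC by rewrite -natrM -pE -natr1; ring.
by rewrite th_mul; ring.
Qed.

Lemma delta_neq0 : 2 * th - 1 != 0.
Proof.
rewrite -sqrf_eq0 delta_sq oppr_eq0 pnatr_eq0.
by apply/negP => /eqP p0; move: pE; rewrite p0; lia.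
Qed.

Lemma ZomegaP x : reflect (exists a b : int, x = a%:~R + b%:~R * th) (x \in A).
Proof.
apply: (iffP idP) => [|[a [b ->]]]; last first.
  by rewrite rpredD ?rpredM ?rpred_int ?mem_Zadj.
pose S : {pred algC} := fun y => `[< exists a b : int, y = a%:~R + b%:~R * th >].
have SP y : reflect (exists a b : int, y = a%:~R + b%:~R * th) (y \in S) by exact: asboolP.
move=> xA; suff /SP : x \in S by [].
apply: (Zadj_ind _ _ xA); last by apply/SP; exists 0, 1; rewrite !rmorph1; ring.
split; first by apply/SP; exists 1, 0; rewrite !rmorph1; ring.
  move=> _ _ /SP [a [b ->]] /SP [a' [b' ->]]; apply/SP.
  by exists (a - a'), (b - b'); rewrite !rmorphB /=; ring.
move=> _ _ /SP [a [b ->]] /SP [a' [b' ->]]; apply/SP.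
exists (a * a' - b * b' * (2 * c)%:Z), (a * b' + b * a' + b * b').
have : (2 * c)%:Z%:~R = 2 * c%:R :> algC by rewrite -pmulrn natrM.
move: (2 * c)%:Z => h hE; rewrite !(rmorphB, rmorphD, rmorphM) /= hE.
transitivity (a%:~R * a'%:~R + (a%:~R * b'%:~R + b%:~R * a'%:~R) * th
   + b%:~R * b'%:~R * (th - th * (1 - th))); first by ring.
by rewrite th_mul; ring.
Qed.

Lemma Zomega_coord (a b a' b' : int) :
  a%:~R + b%:~R * th = a'%:~R + b'%:~R * th -> a = a' /\ b = b'.
Proof.
move=> E; have := congr1 (fun x => x - x^*) E.
rewrite !rmorphD !rmorphM !rmorph_int /= th_conj => E2.
have bb : b%:~R * (2 * th - 1) = b'%:~R * (2 * th - 1).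
  by transitivity (a%:~R + b%:~R * th - (a%:~R + b%:~R * (1 - th)));
    [|rewrite E2]; ring.
have bE : b = b'.
  by apply/eqP; rewrite -(eqr_int algC); apply/eqP/(mulIf delta_neq0).
split => //; move: E; rewrite bE => /addIr /eqP; rewrite eqr_int => /eqP //.
Qed.

Lemma Zomega_norm (a b : int) :
  (a%:~R + b%:~R * th) * (a%:~R + b%:~R * th)^* =
    (a ^+ 2 + a * b + b ^+ 2 * (2 * c)%:Z)%:~R.
Proof.
have : (2 * c)%:Z%:~R = 2 * c%:R :> algC by rewrite -pmulrn natrM.
move: (2 * c)%:Z => h hE.
rewrite !rmorphD !rmorphM !rmorph_int /= th_conj hE.
transitivity (a%:~R ^+ 2 + a%:~R * b%:~R + b%:~R ^+ 2 * (th * (1 - th))).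
  by ring.
by rewrite th_mul; ring.
Qed.

Lemma Zomega_conj x : x \in A -> x^* \in A.
Proof.
by apply: Zadj_rmorph; rewrite /= th_conj rpredB ?rpred1 ?mem_Zadj.
Qed.

Lemma Zomega_norm_nat x : x \in A -> exists n : nat, x * x^* = n%:R.
Proof.
move/ZomegaP => [a [b ->]].
have := mul_conjC_ge0 (a%:~R + b%:~R * th); rewrite Zomega_norm ler0z.
by case: (_ + _) => // n _; exists n.
Qed.

(** Four times the norm of [x + y * th] is (2x + y)^2 + p y^2, so if [p] divides the norm it divides
    2x + y, and [b] is divisible by [2 * th - 1], a square root of -p. Each such division removes
    one factor [p] from the norm. *)
Lemma norm_div_sqrt s M b : prime p -> b \in A ->
  b * b^* = 2 ^+ s * p%:R ^+ M -> b / 2 \notin A ->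
  exists b', [/\ b' \in A, b' * b'^* = 2 ^+ s & b' / 2 \notin A].
Proof.
move=> pp; elim: M b => [|M IH] b bA bN b2.
  by exists b; rewrite bN expr0 mulr1.
have p0 : p%:R != 0 :> algC by rewrite pnatr_eq0 -lt0n prime_gt0.
have pZ : p%:Z = 8 * c%:Z - 1 by lia.
have [x [y bE]] := ZomegaP _ bA.
have N : (x ^+ 2 + x * y + y ^+ 2 * (2 * c)%:Z) = 2 ^+ s * (p%:Z) ^+ M.+1.
  apply/eqP; rewrite -(eqr_int algC) -Zomega_norm -bE bN.
  by rewrite rmorphM !rmorphXn /= -pmulrn.
have [w wE] : exists w : int, 2 * x + y = p%:Z * w.
  have : (p %| `|(2 * x + y) ^+ 2|)%N.
    have -> : (2 * x + y) ^+ 2 = p%:Z * (4 * 2 ^+ s * (p%:Z) ^+ M - y ^+ 2).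
      transitivity (4 * (2 ^+ s * (p%:Z) ^+ M.+1) - p%:Z * y ^+ 2); last first.
        by rewrite exprS; ring.
      by rewrite -N pZ PoszM; ring.
    by rewrite abszM dvdn_mulr.
  rewrite abszX Euclid_dvdX // andbT => /dvdnP [k kE].
  have : (p%:Z %| 2 * x + y)%Z by rewrite dvdzE kE dvdn_mull.
  by case/dvdzP => w ->; exists w; rewrite mulrC.
have [h hE] : exists h : int, y + w = 2 * h.
  by exists (4 * (c%:Z * w) - x); move: wE; rewrite pZ; lia.
have dA : 2 * th - 1 \in A by rewrite rpredB ?rpred1 ?rpredM ?rpred_nat ?mem_Zadj.
(* With d = 2 th - 1 and d^2 = -p, one has 2 b = (2x + y) + y d = p w + y d = d (y - w d), and y - w
   d = 2 (h - w th). *)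
pose b' := h%:~R - w%:~R * th.
have b'A : b' \in A by rewrite rpredB ?rpredM ?rpred_int ?mem_Zadj.
have bb' : b = (2 * th - 1) * b'.
  apply: (@mulfI _ 2); first by rewrite pnatr_eq0.
  transitivity ((2 * x + y)%:~R + y%:~R * (2 * th - 1)).
    by rewrite bE rmorphD rmorphM /=; ring.
  rewrite wE rmorphM /= -pmulrn.
  have -> : p%:R = - (2 * th - 1) ^+ 2 by rewrite delta_sq opprK.
  have yE : y%:~R = 2 * h%:~R - w%:~R :> algC.
    have -> : y = 2 * h - w by lia.
    by rewrite rmorphB rmorphM.
  by rewrite /b' yE; ring.
apply: (IH b') => //.
  apply: (mulfI p0).
  transitivity (b * b^*); last by rewrite bN exprS; ring.
  have dC : (2 * th - 1)^* = - (2 * th - 1).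
    by rewrite rmorphB rmorphM rmorph_nat rmorph1 /= th_conj; ring.
  rewrite bb' rmorphM /= dC.
  have -> : p%:R = - (2 * th - 1) ^+ 2 by rewrite delta_sq opprK.
  by ring.
by apply: contra b2 => b'2; rewrite bb' -mulrA rpredM.
Qed.

(** If an even power of the prime above 2 is principal, so is half that power: this is the absence
    of 2-torsion in the class group, made explicit on generators. It is used to show that [t] is
    odd. *)
Lemma norm_even_half r b : prime p -> (0 < r)%N -> b \in A ->
  b * b^* = 2 ^+ r.*2 -> b / 2 \notin A ->
  exists b', [/\ b' \in A, b' * b'^* = 2 ^+ r & b' / 2 \notin A].
Proof.
move=> pp r0 /ZomegaP [x [y bE]] bN b2.
have pZ : p%:Z = 8 * c%:Z - 1 by lia.
have N : (x ^+ 2 + x * y + y ^+ 2 * (2 * c)%:Z) = 2 ^+ r.*2.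
  by apply/eqP; rewrite -(eqr_int algC) -Zomega_norm -bE bN rmorphXn.
(* If [y] were even, the even norm would make [x] even too, and [b] would be divisible by 2. *)
have yodd : odd `|y|.
  apply: contraNT b2 => yev.
  have [y' yE] := even_intP yev.
  have [x' xE] : exists x' : int, x = 2 * x'.
    apply: even_intP; have : ~~ odd `|x ^+ 2|.
      have -> : x ^+ 2 = 2 * (2 ^+ r.*2.-1 - x * y' - 4 * y' ^+ 2 * c%:Z).
        have : 2 ^+ r.*2 = 2 * 2 ^+ r.*2.-1 :> int by rewrite -exprS prednK // double_gt0.
        rewrite mulrBr mulrBr => <-; rewrite -N yE PoszM; ring.
      by rewrite abszM oddM.
    by rewrite abszX oddX.
  rewrite bE xE yE; apply/ZomegaP; exists x', y'.
  by rewrite !rmorphM /=; field.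
have XY : (`|(2 * x + y)%R| ^ 2 + p * `|y| ^ 2 = (2 ^ r.+1) ^ 2)%N.
  apply/eqP; rewrite -(eqr_nat int) natrD natrM !natrX !natz !abszE.
  rewrite !real_normK ?num_real // pZ -exprM.
  have -> : (r.+1 * 2 = r.*2 + 2)%N by lia.
  by rewrite exprD -N PoszM; apply/eqP; ring.
have oX : odd `|(2 * x + y)%R| by lia.
have op : odd p by lia.
have [u [v [ou ov uv]]] := odd_repr_square_half pp op oX yodd XY.
have [h hE] := odd_diff_even ou ov.
(* This is (v + u d) / 2 with d = 2 th - 1, of norm (v^2 + p u^2) / 4; as [u] is odd, it is not
   divisible by 2. *)
exists (h%:~R + u%:Z%:~R * th); split.
- by apply/ZomegaP; exists h, u.
- have uvZ : (v%:Z) ^+ 2 + p%:Z * (u%:Z) ^+ 2 = 4 * 2 ^+ r.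
    have := congr1 (fun n => n%:R : int) uv.
    by rewrite natrD natrM !natrX !natz !exprS => ->; ring.
  rewrite Zomega_norm; set n := _ + _; suff -> : n = 2 ^+ r by rewrite rmorphXn.
  have vE : v%:Z = 2 * h + u by rewrite -hE subrK.
  by apply: (@mulfI _ 4) => //; rewrite -uvZ pZ vE /n PoszM; ring.
- apply/negP => /ZomegaP [a' [b' E]].
  have : h%:~R + u%:Z%:~R * th = (2 * a')%:~R + (2 * b')%:~R * th.
    rewrite !rmorphM /= -mulrA -mulrDr -E; by field.
  case/Zomega_coord => _ uE; move: (congr1 absz uE) ou; rewrite abszM /= => ->.
  by rewrite oddM.
Qed.

Hypothesis thE : th = omega p.

Lemma inOP x : inO p x <-> x \in A.
Proof. by rewrite /inO -thE; split=> [/ZomegaP|/ZomegaP]. Qed.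

Section PrimeAbove2.

Variable P : algC -> Prop.
Hypotheses (Ppr : prime_ideal p P) (P2 : P 2).

(** [P] contains [th * (1 - th)], hence one factor [v], and not the other factor [u = 1 - v]. As
    [u * v] is divisible by 2, [P] = (2, v) consists of the [x] with [u * x] divisible by 2. This
    test replaces ideal computations from here on. *)
Lemma prime_above2 : exists2 u, u = th \/ u = 1 - th &
  (forall x, P x <-> x \in A /\ u * x / 2 \in A) /\ ~ P u.
Proof.
have [[PO P0 PD PM] P1 Pp] := Ppr.
have PMA r x : r \in A -> P x -> P (r * x) by move=> /inOP; exact: PM.
have PpA a b : a \in A -> b \in A -> P (a * b) -> P a \/ P b.
  by move=> /inOP aO /inOP bO; exact: Pp.
have tA : th \in A by exact: mem_Zadj.
have t1A : 1 - th \in A by rewrite rpredB ?rpred1.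
have key u v : u + v = 1 -> u * v = 2 * c%:R -> u \in A -> v \in A ->
    (forall x, x \in A -> exists a b : int, x = a%:~R + b%:~R * v) -> P v ->
    (forall x, P x <-> x \in A /\ u * x / 2 \in A) /\ ~ P u.
  move=> uv1 uv uA vA coord Pv.
  have nPu : ~ P u by move=> Pu; apply: P1; rewrite -uv1; exact: PD.
  split=> // x; split => [Px|[xA uxA]].
    have xA : x \in A by apply/inOP/PO.
    split=> //; have [a [b xE]] := coord _ xA.
    have Pa : P a%:~R.
      have -> : a%:~R = x + (- b%:~R) * v by rewrite xE; ring.
      by apply: PD => //; apply: PMA; rewrite ?rpredN ?rpred_int.
    have [h aE] : exists h : int, a = h * 2.
      exists (a %/ 2)%Z; apply/eqP; have := divz_eq a 2 => aE.
      have : (a %% 2)%Z = 0 \/ (a %% 2)%Z = 1 by lia.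
      case=> m; first by rewrite {1}aE m addr0.
      case: P1; have -> : 1 = a%:~R + (- (a %/ 2)%Z)%:~R * 2 :> algC.
        by rewrite {1}aE m rmorphD rmorphM rmorphN /=; ring.
      by apply: PD => //; apply: PMA; rewrite ?rpred_int.
    have -> : u * x / 2 = h%:~R * u + b%:~R * c%:R.
      rewrite xE aE; transitivity ((2 * h%:~R * u + b%:~R * (u * v)) / 2).
        by rewrite rmorphM /=; field.
      by rewrite uv; field.
    by rewrite rpredD ?rpredM ?rpred_int ?rpred_nat.
  have : P (u * x).
    have -> : u * x = u * x / 2 * 2 by field.
    exact: PMA.
  by case/(PpA _ _ uA xA).
have : P (th * (1 - th)).
  by rewrite th_mul mulrC; apply: PMA; rewrite ?rpred_nat.
case/(PpA _ _ tA t1A) => Pv.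
  exists (1 - th); first by right.
  apply: (key _ th) => //; [by ring | by rewrite -th_mul mulrC|].
  by move=> x /ZomegaP.
exists th; first by left.
apply: (key _ (1 - th)) => //; first by ring.
move=> x /ZomegaP [a [b ->]]; exists (a + b), (- b).
by rewrite rmorphD rmorphN /=; ring.
Qed.

Lemma prime_above2_conj : exists u,
  [/\ u \in A, u^* = 1 - u, P (1 - u), ~ P u &
      forall x, P x <-> x \in A /\ u * x / 2 \in A].
Proof.
have [u uth [PE nPu]] := prime_above2; exists u.
have [uA u_conj u1A] : [/\ u \in A, u^* = 1 - u & 1 - u \in A].
  by case: uth => ->; rewrite ?rmorphB ?rmorph1 /= th_conj; split => //;
    rewrite ?rpredB ?rpred1 ?mem_Zadj //; ring.
split=> //; apply/PE; split=> //.
have -> : u * (1 - u) / 2 = c%:R; last by rewrite rpred_nat.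
have -> : u * (1 - u) = th * (1 - th) by case: uth => ->; ring.
by rewrite th_mul; field.
Qed.

Lemma inO_ideal : is_ideal p (inO p).
Proof.
split=> [//||x y|r x]; rewrite ?inOP; first exact: rpred0.
- exact: rpredD.
- exact: rpredM.
Qed.

Lemma ideal_pow_ideal I s : is_ideal p I -> is_ideal p (ideal_pow p I s).
Proof.
move=> [IO _ _ _]; elim: s => [|s [sO _ _ _]]; first exact: inO_ideal.
have [_ O0 OD OM] := inO_ideal.
split=> [x|K [_ K0 _ _] //|x y xI yI K KI HK|r x rO xI K KI HK].
- by apply; [exact: inO_ideal | move=> a b /IO aO /sO bO; exact: OM].
- by have [_ _ KD _] := KI; apply: KD; [exact: xI | exact: yI].
- by have [_ _ _ KM] := KI; apply: KM => //; exact: xI.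
Qed.

Lemma ideal_pow_mem (I : algC -> Prop) x s : I x -> ideal_pow p I s (x ^+ s).
Proof.
move=> Ix; elim: s => [|s IH]; first by apply/inOP; rewrite rpred1.
by rewrite exprS => K _ HK; exact: HK.
Qed.

Lemma ideal_pow_sub (I : algC -> Prop) u s x :
  (forall y, I y <-> y \in A /\ u * y / 2 \in A) -> u \in A ->
  ideal_pow p I s x -> x \in A /\ u ^+ s * x / 2 ^+ s \in A.
Proof.
move=> IE uA; elim: s x => [|s IH] x /=.
  by move/inOP => xA; rewrite !expr0 mul1r divr1.
(* The product of ideals is the least ideal containing the products, so it suffices that the claimed
   condition defines an ideal containing them. *)
move=> /(_ (fun y => y \in A /\ u ^+ s.+1 * y / 2 ^+ s.+1 \in A)).
apply=> [|a b /IE [aA uaA] /IH [bA ubA]]; last first.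
  rewrite rpredM //; split=> //.
  have -> : u ^+ s.+1 * (a * b) / 2 ^+ s.+1 =
    (u * a / 2) * (u ^+ s * b / 2 ^+ s).
    by rewrite !exprS; field; rewrite expf_neq0 ?pnatr_eq0.
  exact: rpredM.
split=> [y [yA _]||y z [yA uy] [zA uz]|r y /inOP rA [yA uy]].
- exact/inOP.
- by rewrite mulr0 mul0r rpred0.
- by split; [exact: rpredD | rewrite mulrDr mulrDl; exact: rpredD].
- split; first exact: rpredM.
  have -> : u ^+ s.+1 * (r * y) / 2 ^+ s.+1 = r * (u ^+ s.+1 * y / 2 ^+ s.+1).
    by ring.
  exact: rpredM.
Qed.

(** The ideal (b) has only primes above 2, and not both of them since 2 does not divide [b]; up to
    conjugation of [b] it is therefore the [s]-th power of [P]. *)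
Lemma ideal_pow_principal s b : (0 < s)%N -> b \in A ->
  b * b^* = 2 ^+ s -> b / 2 \notin A -> principal_ideal p (ideal_pow p P s).
Proof.
move=> s0 bA bN b2.
have [u [uA u_conj u1P nPu PE]] := prime_above2_conj.
have u1A : 1 - u \in A by rewrite rpredB ?rpred1.
have [Pid P1 Pp] := Ppr.
have PpA x y : x \in A -> y \in A -> P (x * y) -> P x \/ P y.
  by move=> /inOP xO /inOP yO; exact: Pp.
wlog Pb : b bA bN b2 / P b.
  move=> W; have : P (b * b^*).
    rewrite bN; apply/PE; rewrite rpredX ?rpred_nat //; split=> //.
    rewrite -(prednK s0) exprS mulrCA mulrAC divff ?pnatr_eq0 // mul1r.
    by rewrite rpredM ?rpredX ?rpred_nat.
  case/(PpA _ _ bA (Zomega_conj bA)) => Pb; first exact: (W b).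
  apply: (W b^*) => //; [exact: Zomega_conj | by rewrite conjCK mulrC |].
  by apply: contra b2 => /Zomega_conj; rewrite rmorphM fmorphV rmorph_nat /= conjCK.
have nPb : ~ P b^*.
  move/PE => [_ /Zomega_conj]; rewrite !rmorphM fmorphV rmorph_nat /= conjCK u_conj.
  move=> H1; have [_ H2] := (PE _).1 Pb; case/negP: b2.
  by apply: (@Zadj_comax_div _ u 1 1); rewrite ?expr1.
(* Induction on [k]: the quotient [g] times [b^*] is [u ^+ k * 2 ^+ (s - k)], an element of [P] for
   [k < s], while [b^*] is not in [P]; so [g] is, which allows one more division. *)
have Ub k : (k <= s)%N -> u ^+ k * b / 2 ^+ k \in A.
  elim: k => [|k IH] ks; first by rewrite !expr0 mul1r divr1.
  set g := u ^+ k * b / 2 ^+ k in IH; have gA := IH (ltnW ks).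
  have : P (g * b^*).
    have -> : g * b^* = u ^+ k * 2 ^+ (s - k).
      rewrite /g -(mulrC (b^*)) -!mulrA (mulrCA b^*) (mulrA b^*) (mulrC b^*) bN.
      by rewrite -expfB.
    apply/PE; rewrite rpredM ?rpredX ?rpred_nat //; split=> //.
    have -> : (s - k = (s - k.+1).+1)%N by lia.
    rewrite exprSr !mulrA mulfK ?pnatr_eq0 //.
    by rewrite !rpredM ?rpredX ?rpred_nat.
  case/(PpA _ _ gA (Zomega_conj bA)) => // /PE [_].
  by congr (_ \in A); rewrite /g !exprS; field; rewrite expf_neq0 ?pnatr_eq0.
have bU : (1 - u) ^+ s * b^* / 2 ^+ s \in A.
  have := Zomega_conj (Ub _ (leqnn s)).
  by rewrite !rmorphM !rmorphXn fmorphV rmorphXn rmorph_nat /= u_conj.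
exists b; split=> [|x]; first exact/inOP.
split=> [|[r [rO ->]]].
  move/(ideal_pow_sub PE uA) => [xA xU].
  exists (b^* * x / 2 ^+ s); split.
    apply/inOP/(@Zadj_comax_div _ u s s) => //.
      have -> : u ^+ s * (b^* * x) / 2 ^+ s = b^* * (u ^+ s * x / 2 ^+ s) by ring.
      by rewrite rpredM ?Zomega_conj.
    have -> : (1 - u) ^+ s * (b^* * x) / 2 ^+ s =
      (1 - u) ^+ s * b^* / 2 ^+ s * x by ring.
    by rewrite rpredM.
  by rewrite !mulrA bN mulrAC divff ?mul1r // expf_neq0 ?pnatr_eq0.
have [_ _ sD sM] := ideal_pow_ideal s Pid.
have [a1 [b1 [a1A b1A ab1]]] := Zadj_comax s s uA.
have -> : b * r = a1 * r * (u ^+ s * b / 2 ^+ s) * 2 ^+ s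
    + b1 * r * b * (1 - u) ^+ s.
  transitivity ((a1 * u ^+ s + b1 * (1 - u) ^+ s) * (b * r)).
    by rewrite ab1 mul1r.
  by field; rewrite expf_neq0 ?pnatr_eq0.
move/inOP in rO; apply: sD; apply: sM; try exact: ideal_pow_mem.
  by apply/inOP; apply: rpredM; [exact: rpredM | exact: Ub].
by apply/inOP; rewrite !rpredM.
Qed.

(** The norm of a generator [b] divides [2 ^ (s + s)], so it is some [2 ^ j]. The element [u ^+ s],
    not divisible by 2, fixes [j]: any of [j < s], [j > s] and [b / 2 \in A] would make [u ^+ s / 2]
    integral. *)
Lemma principal_ideal_pow s : (0 < s)%N ->
  principal_ideal p (ideal_pow p P s) ->
  exists b, [/\ b \in A, b * b^* = 2 ^+ s & b / 2 \notin A].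
Proof.
have [u [uA u_conj u1P nPu PE]] := prime_above2_conj.
have [Pid P1 Pp] := Ppr.
move=> s0 [b [/inOP bA bE]].
have Pb : ideal_pow p P s b.
  by apply/bE; exists 1; rewrite mulr1 inOP rpred1.
have [_ ub] := ideal_pow_sub PE uA Pb.
have /bE [r [/inOP rA rE]] := ideal_pow_mem s P2.
have /bE [r' [/inOP r'A r'E]] := ideal_pow_mem s u1P.
have us2 : u ^+ s / 2 \notin A.
  apply/negP => us; apply: nPu.
  have : P (u ^+ s) by apply/PE; rewrite rpredX // -mulrA rpredM.
  elim: (s) => [/P1 //|k IH]; rewrite exprS => /(Pp u) [].
  - exact/inOP.
  - by apply/inOP; rewrite rpredX.
  - by [].
  - exact: IH.
have usE : u ^+ s = b^* * r'^*.
  by rewrite -rmorphM -r'E rmorphXn rmorphB rmorph1 /= u_conj; congr (_ ^+ _); ring.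
exists b; split=> //; last first.
  apply: contra us2 => /Zomega_conj b2.
  have -> : u ^+ s / 2 = (b / 2)^* * r'^*.
    by rewrite usE rmorphM fmorphV rmorph_nat; ring.
  by rewrite rpredM // Zomega_conj.
have [n nE] := Zomega_norm_nat bA; have [k kE] := Zomega_norm_nat rA.
have nk : (n * k = 2 ^ (s + s))%N.
  apply/eqP; rewrite -(eqr_nat algC) natrM natrX exprD -nE -kE.
  have -> : b * b^* * (r * r^*) = (b * r) * (b * r)^* by rewrite rmorphM /=; ring.
  by rewrite -rE rmorphXn rmorph_nat.
have /(dvdn_pfactor _ _ (isT : prime 2)) [j _ nj] : (n %| 2 ^ (s + s))%N.
  by rewrite -nk dvdn_mulr.
have two0 i : (2 : algC) ^+ i != 0 by rewrite expf_neq0 ?pnatr_eq0.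
rewrite nE nj natrX; case: (ltngtP j s) => [js|sj|-> //]; case/negP: us2.
  have -> : u ^+ s / 2 = u ^+ s * b / 2 ^+ s * b^* * 2 ^+ (s - j).-1.
    transitivity (u ^+ s * (b * b^*) * 2 ^+ (s - j).-1 / 2 ^+ s); last by ring.
    have sE : (s = j + (s - j).-1.+1)%N by lia.
    rewrite nE nj natrX {4}sE exprD exprS; field.
    by rewrite !two0.
  by rewrite rpredM ?rpredX ?rpred_nat // rpredM // Zomega_conj.
have -> : u ^+ s / 2 = r * r'^* * 2 ^+ (j - s).-1.
  apply: (mulfI (two0 s.+1)); rewrite exprS.
  transitivity (2 ^+ s * u ^+ s); first by field.
  rewrite {1}rE usE.
  transitivity ((b * b^*) * r * r'^*); first by ring.
  have jE : (j = s + (j - s).-1.+1)%N by lia.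
  by rewrite nE nj natrX {1}jE exprD exprS; ring.
by rewrite !rpredM ?rpredX ?rpred_nat // Zomega_conj.
Qed.

(** Halving as long as possible and then removing [p] would give a generator of a smaller power of
    [P], or of its conjugate, against minimality of [t]. *)
Lemma norm_half_notin t M b : prime p -> is_class_order p P t -> b \in A ->
  b * b^* = 2 ^+ t * p%:R ^+ M -> b / 2 \notin A.
Proof.
move=> pp [t0 [tpr tmin]].
have small s b1 : (0 < s)%N -> b1 \in A -> b1 * b1^* = 2 ^+ s ->
    b1 / 2 \notin A -> (t <= s)%N.
  by move=> s0 b1A b1N b12; apply: tmin => //; exact: ideal_pow_principal b12.
have tE : odd t.
  apply: contraT => te; pose r := t./2.
  have rE : t = r.*2 by rewrite -[LHS]odd_double_half (negPf te).
  have [b1 [b1A b1N b12]] := principal_ideal_pow t0 tpr.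
  have r0 : (0 < r)%N by lia.
  rewrite rE in b1N; have [b' [b'A b'N b'2]] := norm_even_half pp r0 b1A b1N b12.
  by have := small _ _ r0 b'A b'N b'2; lia.
have halfN x s : x / 2 \in A -> x * x^* = 2 ^+ s * p%:R ^+ M ->
    (2 <= s)%N /\ (x / 2) * (x / 2)^* = 2 ^+ (s - 2) * p%:R ^+ M.
  move=> x2 xN; have hN : (x / 2) * (x / 2)^* = 2 ^+ s * p%:R ^+ M / 4.
    by rewrite -xN rmorphM fmorphV rmorph_nat /=; field.
  have s2 : (2 <= s)%N.
    have [n nE] := Zomega_norm_nat x2; rewrite hN in nE.
    have : (2 ^ s * p ^ M = n * 4)%N.
      apply/eqP; rewrite -(eqr_nat algC) !natrM !natrX -nE.
      by apply/eqP; field.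
    have : odd (p ^ M) by rewrite oddX; apply/orP; right; lia.
    by case: (s) => [|[|]] //; rewrite ?expn0 ?expn1; lia.
  split=> //; rewrite hN; have -> : s = (s - 2 + 2)%N by lia.
  by rewrite exprD addnK; field.
(* Halving lowers the exponent [s] by 2, so its oddness keeps it positive and the descent ends at a
   principal power with [0 < s < t]. *)
have nosmall s : odd s -> (s < t)%N -> forall x, x \in A ->
    x * x^* = 2 ^+ s * p%:R ^+ M -> False.
  elim/ltn_ind: s => s IH os st x xA xN.
  have [x2|x2] := boolP (x / 2 \in A).
    have [s2 N2] := halfN _ _ x2 xN.
    by apply: (IH (s - 2)%N _ _ _ _ x2 N2); lia.
  have [x' [x'A x'N x'2]] := norm_div_sqrt pp xA xN x2.
  have s0 : (0 < s)%N by lia.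
  by have := small _ _ s0 x'A x'N x'2; lia.
move=> bA bN; apply/negP => b2; have [t2 N2] := halfN _ _ b2 bN.
by apply: (nosmall (t - 2)%N _ _ _ b2 N2); lia.
Qed.

End PrimeAbove2.
End QuadraticOrder.

(** * Powers of 2 modulo m *)

Section Pow2Roots.

Variables (m N : nat) (z : algC).
Hypothesis m_odd : odd m.

Lemma coprime_pow2 i : coprime m (2 ^ i).
Proof. by rewrite coprimeXr // coprimen2. Qed.

Hypothesis pow2_dvd : forall j, 2 ^ j = 1 %[mod m] -> (N %| j)%N.

Lemma pow2_inj i j : (i < N)%N -> (j < N)%N -> 2 ^ i = 2 ^ j %[mod m] -> i = j.
Proof.
wlog ij : i j / (i <= j)%N.
  move=> W iN jN E; have [ij|/ltnW ji] := leqP i j; first exact: W.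
  by apply/esym; apply: W.
move=> iN jN /esym /eqP; rewrite eqn_mod_dvd ?leq_exp2l //.
have -> : (2 ^ j - 2 ^ i = 2 ^ i * (2 ^ (j - i) - 1))%N.
  by rewrite mulnBr -expnD subnKC // muln1.
rewrite Gauss_dvdr ?coprime_pow2 // -eqn_mod_dvd ?expn_gt0 // => /eqP /pow2_dvd.
by move/dvdn_leq; lia.
Qed.

Hypotheses (m3 : (2 < m)%N) (N_odd : odd N).
Hypothesis pow2N : 2 ^ N = 1 %[mod m].

(** If -1 were a power of 2 modulo [m], its square being 1 and [N] being odd, that power would
    itself be 1, so [m] would divide 2. *)
Lemma pow2_opp i j : ~~ (m %| 2 ^ i + 2 ^ j)%N.
Proof.
wlog ij : i j / (i <= j)%N.
  by move=> W; have [/W //|/ltnW /W] := leqP i j; rewrite addnC.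
have -> : (2 ^ i + 2 ^ j = 2 ^ i * (1 + 2 ^ (j - i)))%N.
  by rewrite mulnDr muln1 -expnD subnKC.
rewrite Gauss_dvdr ?coprime_pow2 //; set d := (j - i)%N; apply/negP => md.
have d1 : 2 ^ d = 1 %[mod m].
  have /pow2_dvd : 2 ^ (2 * d) = 1 %[mod m].
    apply/eqP; rewrite eqn_mod_dvd ?expn_gt0 // mulnC expnM.
    by rewrite -[X in (_ - X)%N](exp1n 2) subn_sqr dvdn_mull // addnC.
  rewrite Gauss_dvdr ?coprimen2 // => /dvdnP [k ->].
  by rewrite mulnC expnM -modnXm pow2N modnXm exp1n.
have : (m %| 2)%N.
  move: md; rewrite /dvdn -modnDmr d1 modnDmr => //.
by move/dvdn_leq; lia.
Qed.

Hypothesis z_prim : m.-primitive_root z.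

(** When [totient m = N.*2] these are all the primitive [m]-th roots of unity: the powers of 2 have
    index 2 and -1 represents the other coset. *)
Definition pow2_roots :=
  [seq z ^+ (2 ^ k) | k <- iota 0 N] ++ [seq z^-1 ^+ (2 ^ k) | k <- iota 0 N].

Lemma size_pow2_roots : size pow2_roots = N.*2.
Proof. by rewrite size_cat !size_map size_iota addnn. Qed.

Lemma uniq_pow2_roots : uniq pow2_roots.
Proof.
have inj : {in iota 0 N &, injective (fun k => z ^+ (2 ^ k))}.
  move=> i j; rewrite !mem_iota /= => iN jN /eqP.
  by rewrite (eq_prim_root_expr z_prim) => /eqP; exact: pow2_inj.
have z0 : z != 0.
  apply/eqP => z0; have /eqP := prim_expr_order z_prim.
  by rewrite z0 expr0n (gtn_eqF (ltn_trans _ m3)) //= eq_sym oner_eq0.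
rewrite cat_uniq map_inj_in_uniq // iota_uniq map_inj_in_uniq ?iota_uniq ?andbT.
  apply/hasPn => _ /mapP [j jN ->]; apply/mapP => [[i iN /eqP]].
  rewrite exprVn -(inj_eq (mulfI (expf_neq0 (2 ^ j) z0))) divff ?expf_neq0 //.
  rewrite eq_sym -exprD -(prim_order_dvd z_prim) => H.
  by have := pow2_opp j i; rewrite H.
by move=> i j iN jN; rewrite !exprVn => /invr_inj; exact: inj.
Qed.

End Pow2Roots.

Lemma rmorph_intpoly (u : {rmorphism algC -> algC}) (P : {poly int}) y :
  u (map_poly intr P).[y] = (map_poly intr P).[u y].
Proof.
rewrite -horner_map -map_poly_comp; congr (_.[_]).
by apply: eq_map_poly => a /=; rewrite rmorph_int.
Qed.

Lemma sum_unity_root (C : numClosedFieldType) n (v : C) : v ^+ n = 1 ->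
  \sum_(j < n) v ^+ j = if v == 1 then n%:R else 0.
Proof.
move=> vn; case: eqP => [->|/eqP v1].
  by under eq_bigr do rewrite expr1n; rewrite sumr_const card_ord.
have v1' : v - 1 != 0 by rewrite subr_eq0.
by apply: (mulfI v1'); rewrite mulr0 -subrX1 vn subrr.
Qed.

(** * Gauss periods *)

Definition gauss_period f (w : algC) := \sum_(k < f) w ^+ (2 ^ k).

Section GaussPeriod.

Variables (p f c : nat) (y : algC).
Hypotheses (pE : p.+1 = (8 * c)%N) (fE : p = f.*2.+1) (f_odd : odd f).
Hypothesis pow2f : 2 ^ f = 1 %[mod p].
Hypothesis pow2_dvd : forall j, 2 ^ j = 1 %[mod p] -> (f %| j)%N.
Hypothesis y_prim : p.-primitive_root y.

Local Notation period := (gauss_period f).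

Lemma period_sq w : w ^+ p = 1 -> period (w ^+ 2) = period w.
Proof.
move=> wp; rewrite /gauss_period; under eq_bigr do rewrite -exprM -expnS.
have f0 : (0 < f)%N by case: f f_odd.
case: f f0 pow2f => // g _ p2.
rewrite big_ord_recr big_ord_recl /= addrC; congr (_ + _).
by rewrite -(expr_mod _ wp) p2 (expr_mod _ wp).
Qed.

Lemma period_conj w : w ^+ p = 1 -> (period w)^* = period w^-1.
Proof.
move=> wp; rewrite rmorph_sum; apply: eq_bigr => k _.
by rewrite rmorphXn /= (conj_unity_root _ wp) // fE.
Qed.

Let py : y ^+ p = 1 := prim_expr_order y_prim.

Lemma period_pow2 i : period (y ^+ (2 ^ i)) = period y.
Proof.
elim: i => [|i IH]; first by rewrite expr1.
by rewrite expnSr exprM period_sq // -exprM mulnC exprM py expr1n.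
Qed.

Lemma roots_pow2 : perm_eq (pow2_roots f y) [seq y ^+ j | j <- iota 1 p.-1].
Proof.
have p3 : (2 < p)%N by lia.
have us : uniq (pow2_roots f y).
  by apply: (uniq_pow2_roots (m := p)) => //; lia.
have ut : uniq [seq y ^+ j | j <- iota 1 p.-1].
  rewrite map_inj_in_uniq ?iota_uniq // => i j; rewrite !mem_iota => iN jN /eqP.
  rewrite (eq_prim_root_expr y_prim) !modn_small; [by move/eqP | lia | lia].
have sub : {subset pow2_roots f y <= [seq y ^+ j | j <- iota 1 p.-1]}.
  have key w : w ^+ p = 1 -> w != 1 -> w \in [seq y ^+ j | j <- iota 1 p.-1].
    move=> wp w1; have [j wE] := prim_rootP y_prim wp; have := ltn_ord j.
    move=> jp; apply/mapP; exists (j : nat); rewrite ?mem_iota //.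
    have : (j != 0 :> nat) by apply: contraNneq w1 => j0; rewrite wE j0 expr0.
    by lia.
  have n1 k : y ^+ (2 ^ k) != 1.
    rewrite -(prim_order_dvd y_prim); apply/negP => /gcdn_idPl.
    have /eqP -> : coprime p (2 ^ k) by apply: coprime_pow2; lia.
    by lia.
  move=> w; rewrite mem_cat => /orP [] /mapP [k _ ->]; apply: key => //.
  - by rewrite -exprM mulnC exprM py expr1n.
  - by rewrite -exprM mulnC exprM exprVn py invr1 expr1n.
  - by rewrite exprVn invr_eq1.
have le : (size [seq y ^+ j | j <- iota 1 p.-1] <= size (pow2_roots f y))%N.
  by rewrite size_pow2_roots size_map size_iota fE.
by have [_ eqs] := uniq_min_size us sub le; apply: uniq_perm.
Qed.

Lemma period_trace : period y + (period y)^* = -1.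
Proof.
have -> : period y + (period y)^* = \sum_(w <- pow2_roots f y) w.
  have sumE v : period v = \sum_(k <- iota 0 f) v ^+ (2 ^ k).
    rewrite /gauss_period -(big_mkord xpredT (fun k => v ^+ (2 ^ k))).
    by rewrite /index_iota subn0.
  by rewrite period_conj // big_cat /= !big_map !sumE.
rewrite (perm_big _ roots_pow2) /= big_map.
have := sum_unity_root py; rewrite -(big_mkord xpredT (fun j => y ^+ j)).
have -> : (y == 1) = false.
  apply/negbTE; rewrite -[y]expr1 -(prim_order_dvd y_prim) dvdn1; lia.
rewrite big_ltn ?fE // expr0 => /eqP; rewrite addrC addr_eq0 => /eqP <-.
by rewrite /index_iota /= subn1.
Qed.

(** The squared moduli of the periods at all [y ^+ j] add up to [p * f] by orthogonality. The term
    [j = 0] is [f ^ 2], and the [2 * f] others are equal, each [y ^+ j] being conjugate to [y] by a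
    power of 2 up to inversion. *)
Lemma period_norm : period y * (period y)^* = 2 * c%:R.
Proof.
have p0 : (0 < p)%N by rewrite fE.
have nE j : (0 < j < p)%N ->
    period (y ^+ j) * (period (y ^+ j))^* = period y * (period y)^*.
  move=> jp; have : y ^+ j \in pow2_roots f y.
    by rewrite (perm_mem roots_pow2) map_f // mem_iota; lia.
  rewrite mem_cat => /orP [] /mapP [k _ ->]; first by rewrite period_pow2.
  have kp : (y ^+ (2 ^ k)) ^+ p = 1 by rewrite -exprM mulnC exprM py expr1n.
  by rewrite exprVn -period_conj // period_pow2 conjCK mulrC.
have S : \sum_(j < p) period (y ^+ j) * (period (y ^+ j))^* = p%:R * f%:R.
  transitivity (\sum_(k < f) \sum_(l < f) \sum_(j < p)
     (y ^+ (2 ^ k) / y ^+ (2 ^ l)) ^+ j).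
    under [RHS]eq_bigr do rewrite exchange_big.
    rewrite [RHS]exchange_big; apply: eq_bigr => j _ /=.
    have yj : (y ^+ j) ^+ p = 1 by rewrite -exprM mulnC exprM py expr1n.
    rewrite period_conj // big_distrlr /=.
    apply: eq_bigr => k _; apply: eq_bigr => l _.
    rewrite exprVn -!exprM exprMn exprVn -!exprM.
    by rewrite (mulnC j) (mulnC j).
  transitivity (\sum_(k < f) \sum_(l < f) (if l == k then p%:R else 0 : algC)).
    apply: eq_bigr => k _; apply: eq_bigr => l _.
    rewrite sum_unity_root; last first.
      by rewrite exprMn exprVn -!exprM !(mulnC _ p) !exprM py !expr1n divr1.
    have y0 : y ^+ (2 ^ l) != 0.
      apply/eqP => y0; have := congr1 (fun w => w ^+ p) y0.
      rewrite /= -exprM mulnC exprM py expr1n expr0n (gtn_eqF p0) => /eqP.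
      by rewrite oner_eq0.
    rewrite -(inj_eq (mulIf y0)) divfK // mul1r (eq_prim_root_expr y_prim).
    case: (l =P k) => [->|/eqP lk]; first by rewrite eqxx.
    have po : odd p by lia.
    case: eqP => // E; case/eqP: lk; apply: val_inj => /=.
    exact/esym/(pow2_inj po pow2_dvd (ltn_ord _) (ltn_ord _) E).
  under eq_bigr do rewrite -big_mkcond big_pred1_eq.
  by rewrite sumr_const card_ord mulr_natr.
move: S; rewrite -(big_mkord xpredT (fun j =>
  period (y ^+ j) * (period (y ^+ j))^*)) big_ltn //.
have -> : period (y ^+ 0) = f%:R.
  rewrite /gauss_period expr0; under eq_bigr do rewrite expr1n.
  by rewrite sumr_const card_ord.
rewrite big_nat (eq_bigr (fun=> period y * (period y)^*)) => [|j]; last exact: nE.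
rewrite -big_nat sumr_const_nat rmorph_nat => S.
have f0 : f%:R != 0 :> algC by rewrite pnatr_eq0; lia.
have pR : p%:R = 2 * f%:R + 1 :> algC by rewrite fE -addn1 -muln2 natrD natrM; ring.
have fR : f%:R = 4 * c%:R - 1 :> algC.
  have -> : 4 * c%:R = f.+1%:R :> algC by rewrite -natrM; congr (_%:R); lia.
  by rewrite -natr1; ring.
have p1 : (p - 1 = 2 * f)%N by lia.
apply: (mulfI f0); apply: (@mulfI _ 2); first by rewrite pnatr_eq0.
move: S; rewrite p1 -[_ *+ (2 * f)]mulr_natl natrM => S.
transitivity (p%:R * f%:R - f%:R * f%:R : algC); first by rewrite -S; ring.
by rewrite pR fR; ring.
Qed.

(** By its trace -1 and norm [2 * c], the negated period satisfies the same quadratic equation as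
    [th]. The equation does not tell its two roots apart, hence the two cases. *)
Lemma omega_period th : th * (1 - th) = 2 * c%:R ->
  th = - period y \/ th = 1 + period y.
Proof.
move=> thE; have : (th + period y) * (th + (period y)^*) = 0.
  transitivity (th ^+ 2 + th * (period y + (period y)^*) + period y * (period y)^*).
    by ring.
  by rewrite period_trace period_norm -thE; ring.
move/eqP; rewrite mulf_eq0 !addr_eq0 => /orP [] /eqP ->; [by left|right].
transitivity (period y - (period y + (period y)^*)); first by ring.
by rewrite period_trace; ring.
Qed.

End GaussPeriod.

(** * Cyclotomic integers and the Frobenius automorphism at 2 *)

Section Cyclotomic.

Variables (m N : nat) (z : algC).
Hypothesis z_prim : m.-primitive_root z.

Local Notation A := (Zadj z).

Let m0 : (0 < m)%N := prim_order_gt0 z_prim.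
Let zm : z ^+ m = 1 := prim_expr_order z_prim.

Lemma prim_root_conj : z^* = z^-1.
Proof. exact: conj_unity_root zm. Qed.

Lemma prim_root_neq0 : z != 0.
Proof.
apply/eqP => z0; move/eqP: zm.
by rewrite z0 expr0n (gtn_eqF m0) eq_sym oner_eq0.
Qed.

Lemma prim_root_inv : z^-1 = z ^+ m.-1.
Proof.
apply: (mulfI prim_root_neq0).
by rewrite divff ?prim_root_neq0 // -exprS prednK.
Qed.

Lemma Zcyc_conj x : x \in A -> x^* \in A.
Proof.
apply: Zadj_rmorph; rewrite /= prim_root_conj prim_root_inv.
by rewrite rpredX ?mem_Zadj.
Qed.

Lemma Zcyc_int x : x \in A -> x \in Crat -> x \in Num.int.
Proof. exact/Zadj_int/(Aint_prim_root z_prim). Qed.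

Lemma Zcyc_half : 2^-1 \notin A.
Proof. exact/Zadj_half/(Aint_prim_root z_prim). Qed.

Hypotheses (m_odd : odd m) (m3 : (2 < m)%N) (N_odd : odd N).
Hypothesis pow2N : 2 ^ N = 1 %[mod m].
Hypothesis pow2_dvd : forall j, 2 ^ j = 1 %[mod m] -> (N %| j)%N.
Hypothesis totE : totient m = N.*2.
Variable sg : {rmorphism algC -> algC}.
Hypothesis sgz : sg z = z ^+ 2.

Lemma sg_Zcyc x : x \in A -> sg x \in A.
Proof. by apply: Zadj_rmorph; rewrite sgz rpredX ?mem_Zadj. Qed.

Lemma sg_conj x : x \in A -> sg x^* = (sg x)^*.
Proof.
move/ZadjP => [P ->]; rewrite !rmorph_intpoly sgz.
rewrite [X in _ = _.[X]]rmorphXn /=; congr (_.[_]).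
by rewrite prim_root_conj fmorphV sgz exprVn.
Qed.

Lemma iter_sg P k :
  iter k sg (map_poly intr P).[z] = (map_poly intr P).[z ^+ (2 ^ k)].
Proof.
elim: k => [|k IH]; first by rewrite expr1.
by rewrite iterS IH rmorph_intpoly rmorphXn /= sgz -exprM expnS.
Qed.

Lemma iter_sgN x : x \in A -> iter N sg x = x.
Proof.
move/ZadjP => [P ->]; rewrite iter_sg -(expr_mod _ zm) pow2N.
by rewrite (expr_mod _ zm).
Qed.

(* Modulo 'Phi_m, an element of Z[z] is the value of a polynomial of degree less
   than [totient m], and this polynomial minus [x] has too many roots. *)
Lemma Zcyc_fixed_int x : x \in A -> sg x = x -> x^* = x -> x \in Num.int.
Proof.
move=> xA sx cx; have [P0 xE0] := ZadjP _ _ xA.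
have [P [PE sP]] : exists P : {poly int},
    (forall w : algC, m.-primitive_root w -> (map_poly intr P0).[w] = (map_poly intr P).[w])
    /\ (size P <= N.*2)%N.
  have := @root_Cyclotomic_char0 algC m.
  have := Cyclotomic_monic m; have := size_Cyclotomic m.
  move: 'Phi_m => F sF Fmon Froot; exists (Pdiv.Ring.rmodp P0 F); split; last first.
    by rewrite -ltnS -totE -sF Pdiv.Ring.ltn_rmodp monic_neq0.
  move=> w /Froot /rootP Fw.
  have := Pdiv.RingMonic.rdivp_eq Fmon P0.
  move: (Pdiv.Ring.rdivp _ _) (Pdiv.Ring.rmodp _ _) => q r ->.
  by rewrite rmorphD rmorphM /= !hornerE Fw mulr0 add0r.
have xP : x = (map_poly intr P).[z] by rewrite -PE.
have xk k : x = (map_poly intr P).[z ^+ (2 ^ k)].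
  by rewrite -iter_sg -xP; elim: k => //= k <-.
have xk' k : x = (map_poly intr P).[z^-1 ^+ (2 ^ k)].
  rewrite -{1}cx {1}(xk k) (rmorph_intpoly (Num.conj)) rmorphXn /=.
  by rewrite prim_root_conj.
pose Q : {poly algC} := map_poly intr P - x%:P.
have [Q0|Q0] := eqVneq Q 0.
  have := congr1 (fun R : {poly algC} => R`_0) Q0.
  rewrite coefB coef_map coefC coef0 /= => /eqP; rewrite subr_eq0 => /eqP <-.
  exact: rpred_int.
have : (size (pow2_roots N z) < size Q)%N.
  apply: max_poly_roots Q0 _ _; last exact: (uniq_pow2_roots (m := m)).
  apply/allP => w; rewrite mem_cat => /orP [] /mapP [k _ ->].
    by rewrite rootE !hornerE -xk subrr.
  by rewrite rootE !hornerE -xk' subrr.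
rewrite size_pow2_roots ltnNge => /negP []; apply: leq_trans (size_polyD _ _) _.
rewrite geq_max size_polyN (leq_trans (size_poly _ _)) //=.
by apply: leq_trans (size_polyC_leq1 _) _; case: N N_odd.
Qed.

(** [sg] lifts the Frobenius at 2: the congruence is an equality at [z] and is preserved by
    differences and products. *)
Lemma Zcyc_frobenius x : x \in A -> (x ^+ 2 - sg x) / 2 \in A.
Proof.
move=> xA; suff /andP [] : (x \in A) && ((x ^+ 2 - sg x) / 2 \in A) by [].
move: x xA; apply: (@Zadj_ind [pred x | (x \in A) && ((x ^+ 2 - sg x) / 2 \in A)]).
  split=> [|a b /andP [aA aF] /andP [bA bF]|a b /andP [aA aF] /andP [bA bF]].
  - by rewrite inE rpred1 rmorph1 expr1n subrr mul0r rpred0.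
  - rewrite inE rpredB //= rmorphB /=.
    have -> : ((a - b) ^+ 2 - (sg a - sg b)) / 2 =
      (a ^+ 2 - sg a) / 2 - (b ^+ 2 - sg b) / 2 + b * (b - a) by field.
    by rewrite rpredD ?rpredM ?rpredB.
  - rewrite inE rpredM //= rmorphM /=.
    have -> : ((a * b) ^+ 2 - (sg a * sg b)) / 2 =
      (a ^+ 2 - sg a) / 2 * b ^+ 2 + sg a * ((b ^+ 2 - sg b) / 2) by field.
    by rewrite rpredD // rpredM // ?rpredX // sg_Zcyc.
by rewrite inE mem_Zadj sgz subrr mul0r rpred0.
Qed.

Lemma Zcyc_frobenius_iter x k : x \in A -> (x ^+ (2 ^ k) - iter k sg x) / 2 \in A.
Proof.
move=> xA; elim: k => [|k IH]; first by rewrite expr1 subrr mul0r rpred0.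
have -> : (x ^+ (2 ^ k.+1) - iter k.+1 sg x) / 2 =
  ((x ^+ (2 ^ k)) ^+ 2 - sg (x ^+ (2 ^ k))) / 2 + sg ((x ^+ (2 ^ k) - iter k sg x) / 2).
  by rewrite rmorphM rmorphB fmorphV rmorph_nat -exprM -expnSr /=; field.
by rewrite rpredD ?sg_Zcyc // Zcyc_frobenius // rpredX.
Qed.

Section Theta.

Variables (p c : nat) (th : algC).
Hypotheses (p_pr : prime p) (pE : p.+1 = (8 * c)%N) (th_conj : th^* = 1 - th).
Hypotheses (th_mul : th * (1 - th) = 2 * c%:R).
Hypotheses (thA : th \in A) (sg_th : sg th = th).

Lemma Zcyc_fixed x : x \in A -> sg x = x -> x \in Zadj th.
Proof.
move=> xA sx; have cA := Zcyc_conj xA.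
have pZ : p%:Z = 8 * c%:Z - 1 by lia.
have scx : sg x^* = x^* by rewrite sg_conj // sx.
have /intrP [s sE] : x + x^* \in Num.int.
  apply: Zcyc_fixed_int; rewrite ?rpredD // rmorphD /= ?sx ?scx //.
  by rewrite conjCK addrC.
have /intrP [n nE] : x * x^* \in Num.int.
  apply: Zcyc_fixed_int; rewrite ?rpredM // rmorphM /= ?sx ?scx //.
  by rewrite conjCK mulrC.
have [d dE] : exists d, d = 2 * th - 1 by exists (2 * th - 1).
have dA : d \in A by rewrite dE rpredB ?rpred1 ?rpredM ?rpred_nat.
have dC : d^* = - d.
  by rewrite dE rmorphB rmorphM rmorph_nat rmorph1 /= th_conj; ring.
have d2 : d ^+ 2 = - p%:R by rewrite dE (delta_sq pE th_mul).
have d0 : d != 0 by rewrite dE (delta_neq0 pE th_mul).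
have /intrP [k kE] : (x - x^*) * d \in Num.int.
  apply: Zcyc_fixed_int; first by rewrite rpredM ?rpredB.
    by rewrite rmorphM rmorphB /= sx scx dE rmorphB rmorphM rmorph_nat rmorph1 sg_th.
  by rewrite rmorphM rmorphB /= conjCK dC; ring.
have k2 : k ^+ 2 = p%:Z * (4 * n - s ^+ 2).
  apply/eqP; rewrite -(eqr_int algC) !rmorphM rmorphB !rmorphM /= -kE -sE -nE.
  rewrite -pmulrn -[p%:R]opprK -d2; apply/eqP; ring.
have [k1 k1E] : exists k1 : int, k = p%:Z * k1.
  have : (p %| `|k ^+ 2|)%N by rewrite k2 abszM dvdn_mulr.
  rewrite abszX Euclid_dvdX // andbT => /dvdnP [k' k'E].
  have : (p%:Z %| k)%Z by rewrite dvdzE k'E dvdn_mull.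
  by case/dvdzP => w ->; exists w; rewrite mulrC.
have xx : x - x^* = - k1%:~R * d.
  apply: (mulIf d0); rewrite kE k1E rmorphM /= -pmulrn.
  by rewrite -[p%:R]opprK -d2; ring.
have sk : s ^+ 2 + p%:Z * k1 ^+ 2 = 4 * n.
  have p0 : p%:Z != 0 by rewrite eqz_nat -lt0n prime_gt0.
  apply: (mulfI p0); transitivity (p%:Z * s ^+ 2 + k ^+ 2).
    by rewrite k1E; ring.
  by rewrite k2; ring.
have [h hE] : exists h : int, s + k1 = 2 * h.
  apply: even_intP; have : ~~ odd `|(s + k1) ^+ 2|.
    have -> : (s + k1) ^+ 2 = 2 * (2 * n + s * k1 - (4 * c%:Z - 1) * k1 ^+ 2).
      transitivity (s ^+ 2 + p%:Z * k1 ^+ 2 + 2 * (s * k1) + (1 - p%:Z) * k1 ^+ 2).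
        by ring.
      by rewrite sk pZ; ring.
    by rewrite abszM oddM.
  by rewrite abszX oddX.
have -> : x = h%:~R - k1%:~R * th.
  apply: (@mulfI _ 2); first by rewrite pnatr_eq0.
  transitivity ((x + x^*) + (x - x^*)); first by ring.
  have -> : x + x^* = 2 * h%:~R - k1%:~R.
    have sh : s = 2 * h - k1 by rewrite -hE addrK.
    by rewrite sE sh rmorphB rmorphM.
  by rewrite xx dE; ring.
by rewrite rpredB ?rpredM ?rpred_int ?mem_Zadj.
Qed.

(* [x ^+ (2 ^ N - 1)] is idempotent modulo 2, hence congruent to the trace of
   its conjugates, which lies in Z[th]. *)
Lemma Zcyc_idempotent x : x \in A ->
  exists a : int, (1 - th) * (x ^+ (2 ^ N).-1 - a%:~R) / 2 \in A.
Proof.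
move=> xA; set ep := x ^+ _.
have epA : ep \in A by rewrite rpredX.
have N0 : (0 < N)%N by case: N N_odd.
have ep2 : (ep ^+ 2 - ep) / 2 \in A.
  have F := Zcyc_frobenius_iter N xA; rewrite iter_sgN // in F.
  have -> : (ep ^+ 2 - ep) / 2 = x ^+ (2 ^ N).-2 * ((x ^+ (2 ^ N) - x) / 2).
    have E : (2 ^ N = (2 ^ N).-2.+2)%N.
      by have := ltn_exp2l 0 N (isT : 1 < 2)%N; rewrite N0; case: (2 ^ N)%N => [|[|]].
    by rewrite /ep E /= !exprS; ring.
  by rewrite rpredM // rpredX.
have eps k : (iter k sg ep - ep) / 2 \in A.
  elim: k => [|k IH]; first by rewrite subrr mul0r rpred0.
  have -> : (iter k.+1 sg ep - ep) / 2 = sg ((iter k sg ep - ep) / 2)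
     + (ep ^+ 2 - ep) / 2 - (ep ^+ 2 - sg ep) / 2.
    by rewrite rmorphM rmorphB fmorphV rmorph_nat /=; field.
  by rewrite rpredB ?rpredD ?sg_Zcyc // Zcyc_frobenius.
pose T := \sum_(k < N) iter k sg ep.
have TA : T \in A.
  apply: rpred_sum => k _; elim: (k : nat) => //= j IH; exact: sg_Zcyc.
have sT : sg T = T.
  rewrite rmorph_sum /T /=; under eq_bigr do rewrite -iterS.
  have := iter_sgN epA; case: N N0 => // M _ E.
  by rewrite big_ord_recr /= -/(iter M.+1 sg ep) E big_ord_recl /= addrC.
have Tep : (T - ep) / 2 \in A.
  have -> : (T - ep) / 2 = \sum_(k < N) (iter k sg ep - ep) / 2 + ep * N./2%:R.
    have NE : N%:R = 1 + 2 * N./2%:R :> algC.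
      by rewrite -{1}(odd_double_half N) N_odd natrD -mul2n natrM.
    rewrite -mulr_suml sumrB sumr_const card_ord -/T -[ep *+ N]mulr_natr NE.
    by field.
  by rewrite rpredD ?rpredM ?rpred_nat // rpred_sum.
(* Multiplied by [1 - th], the term [b * th] becomes divisible by 2, so modulo (2, th) only the
   integer [a] remains. *)
have /(ZomegaP th_mul) [a [b TE]] := Zcyc_fixed TA sT.
exists a.
have -> : (1 - th) * (ep - a%:~R) / 2 = b%:~R * c%:R - (1 - th) * ((T - ep) / 2).
  transitivity (b%:~R * (th * (1 - th)) / 2 - (1 - th) * ((T - ep) / 2)).
    by rewrite TE; field.
  by rewrite th_mul; field.
by apply: rpredB; apply: rpredM => //;
  rewrite ?rpred_int ?rpred_nat ?rpredB ?rpred1.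
Qed.

Lemma half_conj_theta : (1 - th) / 2 \notin A.
Proof.
apply/negP => H; have := Zcyc_conj H.
rewrite rmorphM rmorphB rmorph1 fmorphV rmorph_nat /= th_conj => H'.
case/negP: Zcyc_half; have -> : 2^-1 = (1 - th) / 2 + (1 - (1 - th)) / 2 by field.
exact: rpredD.
Qed.

(** This is primality of (2, th) in Z[z]. Modulo it, [w ^+ (2 ^ N).-1] is congruent to 0 or 1, and 0
    forces [w] itself into the ideal because [w ^+ (2 ^ N)] is congruent to [w]. Two elements
    outside have powers congruent to 1, so their product is outside too. *)
Lemma Zcyc_prime_above2 x y : x \in A -> y \in A ->
  (1 - th) * (x * y) / 2 \in A ->
  (1 - th) * x / 2 \in A \/ (1 - th) * y / 2 \in A.
Proof.
have tA : 1 - th \in A by rewrite rpredB ?rpred1.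
have N1 : (2 ^ N = (2 ^ N).-1.+1)%N by rewrite prednK // expn_gt0.
have key w : w \in A -> (1 - th) * w / 2 \in A \/
    (1 - th) * (w ^+ (2 ^ N).-1 - 1) / 2 \in A.
  move=> wA; have [a aE] := Zcyc_idempotent wA.
  have : (a %% 2)%Z = 0 \/ (a %% 2)%Z = 1 by lia.
  have := divz_eq a 2; set h := (a %/ 2)%Z => aE2 [] r; rewrite r in aE2.
    left; have F := Zcyc_frobenius_iter N wA; rewrite iter_sgN // in F.
    have -> : (1 - th) * w / 2 = (1 - th) * (w ^+ (2 ^ N).-1 - a%:~R) / 2 * w
       + (1 - th) * w * h%:~R - (1 - th) * ((w ^+ (2 ^ N) - w) / 2).
      by rewrite aE2 addr0 rmorphM N1 exprSr /=; field.
    apply: rpredB; last exact: rpredM.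
    by apply: rpredD; apply: rpredM; rewrite ?rpred_int // rpredM.
  right.
  have -> : (1 - th) * (w ^+ (2 ^ N).-1 - 1) / 2 =
    (1 - th) * (w ^+ (2 ^ N).-1 - a%:~R) / 2 + (1 - th) * h%:~R.
    by rewrite aE2 rmorphD rmorphM rmorph1 /=; field.
  by rewrite rpredD // rpredM // rpred_int.
move=> xA yA xy; case: (key x xA) => [|xe]; first by left.
case: (key y yA) => [|ye]; first by right.
case/negP: half_conj_theta.
have N2 : (2 ^ N).-1 = (2 ^ N).-2.+1.
  have N0 : (0 < N)%N by case: N N_odd.
  by have := ltn_exp2l 0 N (isT : 1 < 2)%N; rewrite N0; case: (2 ^ N)%N => [|[|]].
have -> : (1 - th) / 2 = (1 - th) * (x * y) / 2 * (x * y) ^+ (2 ^ N).-2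
   - (1 - th) * (x ^+ (2 ^ N).-1 - 1) / 2 * y ^+ (2 ^ N).-1
   - (1 - th) * (y ^+ (2 ^ N).-1 - 1) / 2.
  have -> : (1 - th) * (x * y) / 2 * (x * y) ^+ (2 ^ N).-2 =
     (1 - th) * ((x * y) ^+ (2 ^ N).-1) / 2 by rewrite N2 exprS; ring.
  by rewrite exprMn; field.
apply: rpredB => //; apply: rpredB; apply: rpredM; rewrite // rpredX //.
exact: rpredM.
Qed.

End Theta.
End Cyclotomic.

(** * Cyclotomic units of absolute value 1 *)

Section IntegerRows.

Variable p : nat.
Implicit Type b : 'I_p -> int.

Lemma sum_sqr_diff b :
  \sum_s \sum_s' (b s - b s') ^+ 2 =
    2 * (p%:Z * \sum_s b s ^+ 2 - (\sum_s b s) ^+ 2).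
Proof.
transitivity (\sum_s (p%:Z * b s ^+ 2 + \sum_s' b s' ^+ 2
    - 2 * (b s * \sum_s' b s'))).
  apply: eq_bigr => s _.
  transitivity (\sum_(s' < p) (b s ^+ 2 + b s' ^+ 2 - 2 * (b s * b s'))).
    by apply: eq_bigr => s' _; ring.
  rewrite sumrB big_split /= sumr_const card_ord -!mulr_sumr.
  by rewrite -[_ *+ p]mulr_natl natz.
rewrite sumrB big_split /= sumr_const card_ord -!mulr_sumr -mulr_suml.
by rewrite -[_ *+ p]mulr_natl natz; ring.
Qed.

(* Some [\sum_s' (b s' - b s) ^+ 2] is at most 1, being below average. *)
Lemma row_near_constant b : (0 < p)%N ->
  \sum_s \sum_s' (b s - b s') ^+ 2 <= 2 * (p%:Z - 1) ->
  exists d : int, (forall s, b s = d) \/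
    exists s0 (ep : bool), forall s, b s = d + (-1) ^+ ep * (s == s0)%:R.
Proof.
move=> p0 le; have [s1 G1] : exists s, \sum_s' (b s - b s') ^+ 2 <= 1.
  apply: contrapT => no; have : \sum_(s < p) (2 : int) <= \sum_s \sum_s' (b s - b s') ^+ 2.
    apply: ler_sum => s _; rewrite leNgt; apply/negP => lt; apply: no.
    by exists s; lia.
  rewrite sumr_const card_ord -[_ *+ p]mulr_natl natz; lia.
exists (b s1); have [const|] := pselect (forall s, b s = b s1); first by left.
move/existsNP => [s0 /eqP s0E]; right.
have sq_ge0 s : 0 <= (b s1 - b s) ^+ 2 by apply: sqr_ge0.
move: G1; rewrite (bigD1 s0) //=.
have : 0 <= \sum_(i < p | i != s0) (b s1 - b i) ^+ 2 by apply: sumr_ge0.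
set S := \sum_(i < p | _) _ => S0 G1.
have d2 : (b s1 - b s0) ^+ 2 != 0 by rewrite sqrf_eq0 subr_eq0 eq_sym.
have d1 : (b s1 - b s0) ^+ 2 = 1 by have := sq_ge0 s0; lia.
have S1 : S = 0 by lia.
exists s0, (b s0 < b s1) => s; have [->|ne] := eqVneq s s0.
  by move: d1 => /eqP; rewrite sqrf_eq1 => /orP [] /eqP; case: ltP => /=; lia.
rewrite mulr0 addr0; apply/esym/eqP; rewrite -subr_eq0 -sqrf_eq0.
move/eqP: S1; rewrite psumr_eq0 // => /allP /(_ s).
by rewrite mem_index_enum ne /= => /(_ isT).
Qed.

End IntegerRows.

(** A non-constant row allowed by [row_near_constant] has a single deviation by 1 or -1 and
    contributes exactly 2 (p - 1), which exhausts the total. So there is exactly one such row. *)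
Lemma near_constant_rows n p (a : 'I_n -> 'I_p -> int) : (1 < p)%N ->
  \sum_r \sum_s \sum_s' (a r s - a r s') ^+ 2 = 2 * (p%:Z - 1) ->
  exists (d : 'I_n -> int) r0 s0 (ep : bool), forall r s,
    a r s = d r + (-1) ^+ ep * ((r == r0) && (s == s0))%:R.
Proof.
move=> p1 E; have p0 := ltnW p1.
have D0 r : 0 <= \sum_s \sum_s' (a r s - a r s') ^+ 2.
  by do 2 (apply: sumr_ge0 => ? _); exact: sqr_ge0.
have Dle r : \sum_s \sum_s' (a r s - a r s') ^+ 2 <= 2 * (p%:Z - 1).
  by rewrite -E (bigD1 r) //= lerDl sumr_ge0.
have /boolp.choice [d dP] : forall r, exists d : int, (forall s, a r s = d) \/
    exists s0 (ep : bool), forall s, a r s = d + (-1) ^+ ep * (s == s0)%:R.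
  by move=> r; apply: row_near_constant.
have Dconst r : (forall s, a r s = d r) ->
    \sum_s \sum_s' (a r s - a r s') ^+ 2 = 0.
  by move=> rc; do 2 (apply: big1 => ? _); rewrite !rc subrr expr0n.
have [all_c|/existsNP [r0 nc]] := pselect (forall r, forall s, a r s = d r).
  move: E; rewrite big1 => [|r _]; last exact/Dconst/all_c.
  by lia.
have [//|[s0 [ep r0E]]] := dP r0; exists d, r0, s0, ep => r s.
have Dr0 : \sum_s \sum_s' (a r0 s - a r0 s') ^+ 2 = 2 * (p%:Z - 1).
  pose b s : int := (-1) ^+ ep * (s == s0)%:R.
  transitivity (\sum_s \sum_s' (b s - b s') ^+ 2).
    by do 2 (apply: eq_bigr => ? _); rewrite !r0E /b; ring.
  rewrite sum_sqr_diff (bigD1 s0) //= [X in _ - X ^+ 2](bigD1 s0) //= /b eqxx.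
  rewrite !big1 => [|i /negPf ->|i /negPf ->]; rewrite ?mulr0 ?expr0n //.
  by rewrite !addr0 mulr1 sqrr_sign mulr1.
have [->|ne] := eqVneq r r0; first by rewrite r0E.
rewrite /= mulr0 addr0; case: (dP r) => [-> //|[s1 [ep1 rE]]].
move: E; rewrite (bigD1 r0) //= Dr0 => /(canRL (addKr _)) /eqP; rewrite addNr.
rewrite psumr_eq0 // => /allP /(_ r); rewrite mem_index_enum ne => /(_ isT) /=.
rewrite psumr_eq0 => [/allP /(_ s)|i _]; last by apply: sumr_ge0 => ? _; exact: sqr_ge0.
rewrite mem_index_enum => /(_ isT) /=.
rewrite psumr_eq0 => [/allP H|i _]; last exact: sqr_ge0.
(* The row is now known to be constant, but the choice of [d r] may have described it with an
   exceptional column [s1]; a different column shows that the constant is [d r]. *)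
have [s2 s2s1] : exists s2 : 'I_p, s2 != s1.
  have [lt|] := boolP ((0 : nat) == s1).
    by exists (Ordinal p1); rewrite -val_eqE /= -(eqP lt).
  by exists (Ordinal p0); rewrite -val_eqE.
have := H s2; rewrite mem_index_enum => /(_ isT) /=.
rewrite sqrf_eq0 subr_eq0 => /eqP ->.
by rewrite rE (negPf s2s1) mulr0 addr0.
Qed.

Lemma big_nat_mul_add (n p : nat) (F : nat -> algC) :
  \sum_(0 <= j < n * p) F j = \sum_(r < n) \sum_(s < p) F (r + n * s)%N.
Proof.
rewrite exchange_big /=; elim: p => [|p IH]; first by rewrite muln0 big_geq // big_ord0.
rewrite big_ord_recr /= -IH mulnS addnC (@big_cat_nat _ _ _ (n * p)) ?leq_addr //=.
congr (_ + _); rewrite -{1}[(n * p)%N]add0n big_addn addKn big_mkord.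
by [].
Qed.

Lemma parseval n (x : algC) (b : nat -> int) : n.-primitive_root x ->
  \sum_(k < n) (\sum_(j < n) (b j)%:~R * x ^+ (k * j)) *
     (\sum_(j < n) (b j)%:~R * x ^+ (k * j))^* =
  n%:R * \sum_(j < n) (b j)%:~R ^+ 2.
Proof.
move=> xn; have n0 := prim_order_gt0 xn; have xn1 := prim_expr_order xn.
have x0 := prim_root_neq0 xn.
transitivity (\sum_(j < n) \sum_(l < n) \sum_(k < n)
    (b j)%:~R * (b l)%:~R * (x ^+ j / x ^+ l) ^+ k).
  under [RHS]eq_bigr do rewrite exchange_big.
  rewrite [RHS]exchange_big; apply: eq_bigr => k _ /=.
  rewrite rmorph_sum big_distrlr /=; apply: eq_bigr => j _; apply: eq_bigr => l _.
  rewrite rmorphM rmorph_int rmorphXn /= (prim_root_conj xn) exprMn !exprVn -!exprM.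
  by rewrite (mulnC k) (mulnC k); ring.
rewrite mulr_sumr; apply: eq_bigr => j _.
transitivity (\sum_(l < n) (if l == j then n%:R * (b j)%:~R ^+ 2 else 0 : algC)).
  apply: eq_bigr => l _; rewrite -mulr_sumr sum_unity_root; last first.
    by rewrite exprMn exprVn -!exprM !(mulnC _ n) !exprM xn1 !expr1n divr1.
  rewrite -(inj_eq (mulIf (expf_neq0 l x0))) divfK ?expf_neq0 // mul1r.
  rewrite (eq_prim_root_expr xn) !modn_small // eq_sym -val_eqE /=.
  by case: eqP => [->|_]; ring.
by rewrite -big_mkcond big_pred1_eq.
Qed.

Lemma Zadj_prim_root_sum n (z x : algC) : n.-primitive_root z -> x \in Zadj z ->
  exists b : nat -> int, x = \sum_(j < n) (b j)%:~R * z ^+ j.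
Proof.
move=> zn /ZadjP [P ->]; have n0 := prim_order_gt0 zn.
have [q [r [PE sr]]] : exists q r : {poly int},
    P = q * ('X^n - 1) + r /\ (size r <= n)%N.
  have mon := monicXnsubC (1 : int) n0.
  exists (Pdiv.Ring.rdivp P ('X^n - 1)), (Pdiv.Ring.rmodp P ('X^n - 1)).
  split; first exact: (Pdiv.RingMonic.rdivp_eq mon P).
  rewrite -ltnS -(size_XnsubC (1 : int) n0) Pdiv.Ring.ltn_rmodp.
  exact: monic_neq0.
exists (fun j => r`_j).
have -> : (map_poly intr P).[z] = (map_poly intr r).[z].
  rewrite PE rmorphD rmorphM rmorphB rmorph1 /= map_polyXn !hornerE.
  by rewrite prim_expr_order // subrr mulr0 add0r.
rewrite (@horner_coef_wide _ n) ?(leq_trans (size_poly _ _)) //.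
by apply: eq_bigr => j _; rewrite coef_map.
Qed.

(* Summing [`|b^(k)|^2 = 1] over all [k] prime to [m] gives, by Parseval's
   identity for [m] and for [m / p], the quadratic equation of
   [near_constant_rows]. *)
Lemma Zcyc_unit_norm1 p e (z u : algC) : prime p -> (2 < p)%N ->
  (p ^ e.+1).-primitive_root z -> u \in Zadj z -> u * u^* = 1 ->
  exists k, u = z ^+ k \/ u = - z ^+ k.
Proof.
move=> pp p3; set m1 := (p ^ e)%N; have mE : (p ^ e.+1 = m1 * p)%N by rewrite expnSr.
rewrite mE; set m := (m1 * p)%N => zm uA uN.
have p0 := prime_gt0 pp; have m10 : (0 < m1)%N by rewrite expn_gt0 p0.
have [b uE] := Zadj_prim_root_sum zm uA.
have zm1 := prim_expr_order zm.
pose h k := \sum_(j < m) (b j)%:~R * z ^+ (k * j).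
(* For [k] prime to [p], [h k] is the image of [u] under the automorphism raising [z] to the power
   [k], which commutes with conjugation here. *)
have hN k : ~~ (p %| k)%N -> h k * (h k)^* = 1.
  move=> pk; have ck : coprime k m.
    by rewrite /m -mE coprimeXr // coprime_sym prime_coprime.
  have [sg sgE] := Qn_aut_exists ck.
  have hE : h k = sg u.
    rewrite uE rmorph_sum; apply: eq_bigr => j _ /=.
    by rewrite rmorphM rmorph_int rmorphXn /= sgE // -exprM.
  have -> : (h k)^* = sg u^*.
    rewrite uE /h !rmorph_sum; apply: eq_bigr => j _ /=.
    rewrite !rmorphM !rmorph_int !rmorphXn /= (prim_root_conj zm) fmorphV sgE //.
    by rewrite !exprVn -exprM.
  by rewrite hE -rmorphM uN rmorph1.
have y_prim : p.-primitive_root (z ^+ m1).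
  by have := dvdn_prim_root zm (dvdn_mull m1 (dvdnn p)); rewrite mulnK.
have x_prim : m1.-primitive_root (z ^+ p).
  by have := dvdn_prim_root zm (dvdn_mulr p (dvdnn m1)); rewrite mulKn.
pose a (r : 'I_m1) (s : 'I_p) : int := b (r + m1 * s)%N.
pose B r : int := \sum_(s < p) b (r + m1 * s)%N.
have hp k : h (k * p)%N = \sum_(r < m1) (B r)%:~R * (z ^+ p) ^+ (k * r).
  rewrite /h -(big_mkord xpredT (fun j => (b j)%:~R * z ^+ (k * p * j))).
  rewrite big_nat_mul_add; apply: eq_bigr => r _.
  rewrite rmorph_sum mulr_suml; apply: eq_bigr => s _ /=; congr (_ * _).
  rewrite mulnDr exprD.
  have -> : (k * p * (m1 * s) = m * (k * s))%N by rewrite /m; ring.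
  by rewrite (exprM _ m) zm1 expr1n mulr1 -exprM; congr (z ^+ _); ring.
have S1 : \sum_(k < m) h k * (h k)^* = m%:R * \sum_(r < m1) \sum_(s < p) (a r s)%:~R ^+ 2.
  rewrite /h (parseval _ zm); congr (_ * _).
  by rewrite -(big_mkord xpredT (fun j => (b j)%:~R ^+ 2)) big_nat_mul_add.
have S2 : \sum_(k < m1) h (k * p)%N * (h (k * p)%N)^* =
    m1%:R * \sum_(r < m1) (B r)%:~R ^+ 2.
  by rewrite -(parseval B x_prim); apply: eq_bigr => k _; rewrite hp.
have S3 : \sum_(k < m) h k * (h k)^* =
    \sum_(k < m1) h (k * p)%N * (h (k * p)%N)^* + m1%:R * (p%:R - 1).
  rewrite -(big_mkord xpredT (fun k => h k * (h k)^*)) /m mulnC big_nat_mul_add.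
  rewrite (bigD1 (Ordinal p0)) //=; congr (_ + _).
    by apply: eq_bigr => s _; rewrite add0n mulnC.
  rewrite (eq_bigr (fun=> m1%:R)) => [|r r0].
    rewrite sumr_const cardC1 card_ord -[LHS]mulr_natr -subn1 natrB //.
  rewrite (eq_bigr (fun=> 1)) => [|s _]; first by rewrite sumr_const card_ord.
  apply: hN; rewrite dvdn_addl ?dvdn_mulr // gtnNdvd //.
  by rewrite lt0n; apply: contraNneq r0 => r0; apply/eqP/val_inj.
have key : \sum_r \sum_s \sum_s' (a r s - a r s') ^+ 2 = 2 * (p%:Z - 1).
  under eq_bigr do rewrite sum_sqr_diff.
  rewrite -mulr_sumr sumrB -mulr_sumr; congr (_ * _).
  apply/eqP; rewrite -(eqr_int algC) !rmorphB rmorphM !rmorph_sum /= -pmulrn.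
  have m1R : m1%:R != 0 :> algC by rewrite pnatr_eq0 -lt0n.
  rewrite -(inj_eq (mulfI m1R)); apply/eqP.
  move: S3; rewrite S1 S2 /m natrM => /eqP; rewrite addrC -subr_eq => /eqP <-.
  rewrite mulrBr mulrA; congr (_ * _ - _ * _).
    by apply: eq_bigr => r _; rewrite rmorph_sum; apply: eq_bigr => s _; rewrite rmorphXn.
  by apply: eq_bigr => r _; rewrite rmorphXn.
have [d [r0 [s0 [ep aE]]]] := near_constant_rows (ltnW p3) key.
suff -> : u = (-1) ^+ ep * z ^+ (r0 + m1 * s0).
  by exists (r0 + m1 * s0)%N; case: ep aE => _; rewrite ?expr1 ?mulN1r ?mul1r; auto.
rewrite uE -(big_mkord xpredT (fun j => (b j)%:~R * z ^+ j)) big_nat_mul_add.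
transitivity (\sum_(r < m1) \sum_(s < p) ((d r)%:~R * z ^+ r * (z ^+ m1) ^+ s +
    (-1) ^+ ep * ((r == r0) && (s == s0))%:R * z ^+ (r + m1 * s))).
  apply: eq_bigr => r _; apply: eq_bigr => s _.
  have -> : b (r + m1 * s)%N = a r s by [].
  rewrite aE rmorphD rmorphM rmorphXn rmorphN1 /= rmorph_nat exprD -exprM.
  by ring.
(* The constants [d r] disappear, being multiplied by the sum of all [p]-th roots of unity. *)
under eq_bigr do rewrite big_split /= -mulr_sumr (sum_unity_root (prim_expr_order y_prim)).
have -> : (z ^+ m1 == 1) = false.
  apply/negbTE; rewrite -(prim_order_dvd zm) gtnNdvd // /m -{1}[m1]muln1.
  by rewrite ltn_pmul2l // ltnW.
under eq_bigr do rewrite mulr0 add0r.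
rewrite (bigD1 r0) //= (bigD1 s0) //= !eqxx !big1 ?addr0 ?mulr1 // => [r ne|s ne].
  by apply: big1 => s _; rewrite (negPf ne) mulr0 mul0r.
by rewrite (negPf ne) mulr0 mul0r.
Qed.

(** * The prime above p *)

Section PrimeAboveP.

Variables (p e : nat) (z : algC).
Hypotheses (pp : prime p) (p_odd : odd p).
Hypothesis zm : (p ^ e.+1).-primitive_root z.

Local Notation A := (Zadj z).
Local Notation m := (p ^ e.+1)%N.

Let p0 : (0 < p)%N := prime_gt0 pp.
Let pR : p%:R != 0 :> algC. Proof. by rewrite pnatr_eq0 -lt0n. Qed.
Let zA : z \in A := mem_Zadj z.

Lemma freshman_dream x y : x \in A -> y \in A ->
  ((x + y) ^+ p - x ^+ p - y ^+ p) / p%:R \in A.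
Proof.
move=> xA yA; rewrite exprDn (bigD1 ord0) //= subn0 bin0 mulr1 mulr1n.
rewrite (bigD1 ord_max) /=; last by rewrite -val_eqE /= -lt0n.
rewrite subnn binn expr0 mul1r mulr1n.
rewrite (_ : _ - _ - _ = \sum_(i < p.+1 | (i != ord0) && (i != ord_max))
   x ^+ (p - i) * y ^+ i *+ 'C(p, i)); last by ring.
rewrite mulr_suml rpred_sum // => i /andP [i0 ip].
have /dvdnP [h ->] : (p %| 'C(p, i))%N.
  rewrite prime_dvd_bin // lt0n; move: i0 ip; rewrite -!val_eqE /= => -> ip.
  by rewrite ltn_neqAle ip -ltnS ltn_ord.
rewrite -[_ *+ _]mulr_natr natrM mulrA mulfK //.
by rewrite !rpredM ?rpredX ?rpred_nat.
Qed.

Lemma one_sub_prim_pow k : ((1 - z) ^+ (p ^ k) - (1 - z ^+ (p ^ k))) / p%:R \in A.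
Proof.
elim: k => [|k IH]; first by rewrite !expr1 subrr mul0r rpred0.
have zkA : z ^+ (p ^ k) \in A by rewrite rpredX.
set w := (_ / _) in IH; set v := z ^+ (p ^ k) in w IH zkA.
have E : (1 - z) ^+ (p ^ k) = (1 - v) + p%:R * w.
  by rewrite /w; field.
have F1 := freshman_dream (rpred1 _) (_ : - v \in A).
have F2 := freshman_dream (_ : 1 - v \in A) (_ : p%:R * w \in A).
rewrite expnSr !exprM E -/v.
have -> : ((1 - v + p%:R * w) ^+ p - (1 - v ^+ p)) / p%:R =
  ((1 - v + p%:R * w) ^+ p - (1 - v) ^+ p - (p%:R * w) ^+ p) / p%:R
  + ((1 - v) ^+ p - 1 ^+ p - (- v) ^+ p) / p%:R + p%:R ^+ p.-1 * w ^+ p.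
  rewrite expr1n exprNn -signr_odd p_odd expr1 exprMn.
  have -> : p%:R ^+ p = p%:R * p%:R ^+ p.-1 :> algC by rewrite -exprS prednK.
  by field.
rewrite rpredD //; last by rewrite rpredM ?rpredX ?rpred_nat.
apply: rpredD; [apply: F2 | apply: F1].
- by rewrite rpredB ?rpred1.
- by rewrite rpredM ?rpred_nat.
- by rewrite rpredN.
Qed.

Let zm1 : z ^+ m = 1 := prim_expr_order zm.

Lemma prim_sub1_neq0 : 1 - z != 0.
Proof.
rewrite subr_eq0 eq_sym -[z]expr1 -(prim_order_dvd zm) dvdn1.
by rewrite expnS muln_eq1 negb_and (gtn_eqF (prime_gt1 pp)).
Qed.

Lemma prim_sub1_pow_div : (1 - z) ^+ m / p%:R \in A.
Proof. by have := one_sub_prim_pow e.+1; rewrite zm1 subrr subr0. Qed.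

Lemma one_sub_pow_div j : (1 - z ^+ j) / (1 - z) \in A.
Proof.
have -> : (1 - z ^+ j) / (1 - z) = \sum_(i < j) z ^+ i.
  apply: (mulIf prim_sub1_neq0); rewrite divfK ?prim_sub1_neq0 //.
  by rewrite -opprB subrX1; ring.
by rewrite rpred_sum // => i _; rewrite rpredX.
Qed.

(** As the [p]-th roots of unity add up to 0, [p] is the sum of the differences between 1 and these
    roots, each divisible by [1 - z]. *)
Lemma p_div_prim_sub1 : p%:R / (1 - z) \in A.
Proof.
have yp : p.-primitive_root (z ^+ (p ^ e)).
  have := dvdn_prim_root zm (dvdn_exp (ltn0Sn e) (dvdnn p)).
  by rewrite expnS mulKn.
have := sum_unity_root (prim_expr_order yp).
have -> : (z ^+ (p ^ e) == 1) = false.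
  apply/negbTE; rewrite -[z ^+ _]expr1 -(prim_order_dvd yp) dvdn1.
  by rewrite (gtn_eqF (prime_gt1 pp)).
move=> S; have -> : p%:R = \sum_(k < p) (1 - (z ^+ (p ^ e)) ^+ k) :> algC.
  by rewrite sumrB S subr0 sumr_const card_ord.
by rewrite mulr_suml rpred_sum // => i _; rewrite -exprM one_sub_pow_div.
Qed.

Lemma prim_sub1_not_unit : (1 - z)^-1 \notin A.
Proof.
apply/negP => H; have : p%:R^-1 \in A.
  have -> : p%:R^-1 = (1 - z) ^+ m / p%:R * (1 - z)^-1 ^+ m.
    by rewrite exprVn mulrAC divff ?mul1r // expf_neq0 ?prim_sub1_neq0.
  by rewrite rpredM ?rpredX ?prim_sub1_pow_div.
move/(Zcyc_int zm); rewrite rpredV rpred_nat => /(_ isT) /intrP [k kE].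
have : p%:Z * k = 1.
  by apply/eqP; rewrite -(eqr_int algC) rmorphM /= -kE -pmulrn divff.
by move/(congr1 absz); rewrite abszM /= => /eqP; rewrite muln_eq1 (gtn_eqF (prime_gt1 pp)).
Qed.

Lemma Zcyc_augmentation x : x \in A -> exists a : int, (x - a%:~R) / (1 - z) \in A.
Proof.
move=> xA; suff : `[< x \in A /\ exists a : int, (x - a%:~R) / (1 - z) \in A >].
  by move/asboolP => [].
move: x xA; apply: (@Zadj_ind (fun x => `[< x \in A /\ exists a : int,
  (x - a%:~R) / (1 - z) \in A >])); last first.
  apply/asboolP; split => //; exists 1.
  have -> : (z - 1%:~R) / (1 - z) = -1 by field; exact: prim_sub1_neq0.
  by rewrite rpredN rpred1.
split.
- by apply/asboolP; rewrite rpred1; split=> //; exists 1; rewrite subrr mul0r rpred0.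
- move=> x y /asboolP [xA [a aE]] /asboolP [yA [b bE]]; apply/asboolP.
  split; [exact: rpredB | exists (a - b)].
  have -> : (x - y - (a - b)%:~R) / (1 - z) =
    (x - a%:~R) / (1 - z) - (y - b%:~R) / (1 - z) by rewrite rmorphB /=; ring.
  exact: rpredB.
- move=> x y /asboolP [xA [a aE]] /asboolP [yA [b bE]]; apply/asboolP.
  split; [exact: rpredM | exists (a * b)].
  have -> : (x * y - (a * b)%:~R) / (1 - z) =
    (x - a%:~R) / (1 - z) * y + a%:~R * ((y - b%:~R) / (1 - z)).
    by rewrite rmorphM /=; ring.
  by apply: rpredD; apply: rpredM; rewrite ?rpred_int.
Qed.

(** Modulo [1 - z] every element is congruent to an integer, and [p] is congruent to 0; the residue
    ring is thus a quotient of the field with [p] elements, non-zero because [1 - z] is not a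
    unit. *)
Lemma prim_sub1_prime x y : x \in A -> y \in A -> x * y / (1 - z) \in A ->
  x / (1 - z) \in A \/ y / (1 - z) \in A.
Proof.
move=> xA yA xy; have [a aE] := Zcyc_augmentation xA.
have [b bE] := Zcyc_augmentation yA.
have divA w (k : int) : (w - k%:~R) / (1 - z) \in A -> (p%:Z %| k)%Z -> w / (1 - z) \in A.
  move=> wA /dvdzP [h kE].
  have -> : w / (1 - z) = (w - k%:~R) / (1 - z) + h%:~R * (p%:R / (1 - z)).
    by rewrite kE rmorphM /= -pmulrn; ring.
  by rewrite rpredD // rpredM ?rpred_int ?p_div_prim_sub1.
have [pa|npa] := boolP (p%:Z %| a)%Z; first by left; apply: divA aE pa.
have [pb|npb] := boolP (p%:Z %| b)%Z; first by right; apply: divA bE pb.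
case/negP: prim_sub1_not_unit.
have /coprimezP [[u v] /= uv] : coprimez (a * b) p%:Z.
  by rewrite coprimezE coprime_sym prime_coprime // abszM Euclid_dvdM // negb_or;
    rewrite !dvdzE in npa npb; rewrite npa npb.
have ab : (a * b)%:~R / (1 - z) \in A.
  have -> : (a * b)%:~R / (1 - z) = x * y / (1 - z)
     - (x - a%:~R) / (1 - z) * y - a%:~R * ((y - b%:~R) / (1 - z)).
    by rewrite rmorphM /=; ring.
  by apply: rpredB; [apply: rpredB => // |]; apply: rpredM; rewrite ?rpred_int.
have -> : (1 - z)^-1 = u%:~R * ((a * b)%:~R / (1 - z)) + v%:~R * (p%:R / (1 - z)).
  have uvR : u%:~R * (a * b)%:~R + v%:~R * p%:R = 1 :> algC.
    by rewrite (pmulrn _ p) -!rmorphM -rmorphD uv.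
  transitivity ((u%:~R * (a * b)%:~R + v%:~R * p%:R) / (1 - z)); last by ring.
  by rewrite uvR mul1r.
by apply: rpredD; apply: rpredM; rewrite ?rpred_int // p_div_prim_sub1.
Qed.

(** Total ramification, with an exponent [a] whose value does not matter: take it maximal. Since [p]
    divides [(1 - z) ^+ m], primality of [1 - z] cancels the excess factors one by one until [p]
    divides [(1 - z) ^+ a]. *)
Lemma p_prim_sub1 : exists a r,
  [/\ r \in A, r^-1 \in A & p%:R = (1 - z) ^+ a * r].
Proof.
have l0 := prim_sub1_neq0; have lA : 1 - z \in A by rewrite rpredB ?rpred1.
have bound k : p%:R / (1 - z) ^+ k \in A -> (k <= m)%N.
  move=> kA; rewrite leqNgt; apply/negP => km; case/negP: prim_sub1_not_unit.
  have -> : (1 - z)^-1 = p%:R / (1 - z) ^+ k * ((1 - z) ^+ m / p%:R)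
     * (1 - z) ^+ (k - m).-1.
    have {1}-> : k = (m + (k - m).-1.+1)%N by lia.
    by rewrite exprD exprS; field; rewrite pR l0 !expf_neq0.
  by rewrite rpredM ?rpredX // rpredM // prim_sub1_pow_div.
have ex : exists k, p%:R / (1 - z) ^+ k \in A.
  by exists 0%N; rewrite expr0 divr1 rpred_nat.
case: (ex_maxnP ex bound) => a aA amax.
have step k : (a <= k)%N -> (1 - z) ^+ k.+1 / p%:R \in A -> (1 - z) ^+ k / p%:R \in A.
  move=> ak kA; have : p%:R / (1 - z) ^+ a * ((1 - z) ^+ k.+1 / p%:R) / (1 - z) \in A.
    have -> : p%:R / (1 - z) ^+ a * ((1 - z) ^+ k.+1 / p%:R) / (1 - z) =
      (1 - z) ^+ (k - a).
      have {1}-> : k = (a + (k - a))%N by lia.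
      by rewrite exprS exprD; field; rewrite pR l0 !expf_neq0.
    by rewrite rpredX.
  case/(prim_sub1_prime aA kA) => H.
    have /amax : p%:R / (1 - z) ^+ a.+1 \in A.
      by move: H; congr (_ \in A); rewrite exprS; field; rewrite l0 expf_neq0.
    by rewrite ltnn.
  by move: H; congr (_ \in A); rewrite exprS; field; rewrite l0 pR.
exists a, (p%:R / (1 - z) ^+ a); split=> //; last first.
  by rewrite mulrCA divff ?mulr1 // expf_neq0.
rewrite invf_div; have := prim_sub1_pow_div.
have [n ->] : exists n, m = (a + n)%N by exists (m - a)%N; rewrite subnKC // bound.
elim: n => [|n IH]; first by rewrite addn0.
by rewrite addnS => /(step _ (leq_addr _ _)).
Qed.

(** [1 - z] and its conjugate are associated, so [u] and [u^*] share the factors [1 - z] of their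
    product equally; primality extracts them from [u] one at a time. *)
Lemma Zcyc_norm_ppow_div u M : u \in A -> u * u^* = p%:R ^+ M.*2 ->
  u / p%:R ^+ M \in A.
Proof.
move=> uA uN; have [a [r [rA rVA pE]]] := p_prim_sub1.
have l0 := prim_sub1_neq0; have lA : 1 - z \in A by rewrite rpredB ?rpred1.
have z0 := prim_root_neq0 zm.
have zVA : z^-1 \in A by rewrite (prim_root_inv zm) rpredX.
have r0 : r != 0.
  by apply/eqP => r0; move: pR; rewrite pE r0 mulr0 eqxx.
have [mu [muA muVA mu0 lC]] : exists mu,
    [/\ mu \in A, mu^-1 \in A, mu != 0 & (1 - z)^* = mu * (1 - z)].
  exists (- z^-1); rewrite invrN invrK !rpredN oppr_eq0 invr_eq0; split=> //.
  by rewrite rmorphB rmorph1 /= (prim_root_conj zm); field.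
have div_l j : (j <= a * M)%N -> u / (1 - z) ^+ j \in A.
  elim: j => [|j IH] ja; first by rewrite expr0 divr1.
  set w := u / (1 - z) ^+ j; have wA : w \in A by apply/IH/ltnW.
  have X0 : (1 - z) ^+ j != 0 by rewrite expf_neq0.
  have Z0 : mu ^+ j != 0 by rewrite expf_neq0.
  have [K KE] : exists K, (a * M.*2 = j + j + K.+1)%N.
    have nE := esym (subnKC ja); set n := (_ - _)%N in nE.
    by exists (n + n).+1; rewrite -muln2 mulnA nE; ring.
  have : w * w^* / (1 - z) \in A.
    have -> : w * w^* / (1 - z) = (1 - z) ^+ K * r ^+ M.*2 * mu^-1 ^+ j.
      have -> : w * w^* / (1 - z) = u * u^* / ((1 - z) ^+ j * (mu ^+ j * (1 - z) ^+ j)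
          * (1 - z)).
        by rewrite /w rmorphM fmorphV rmorphXn /= lC exprMn; field; rewrite l0 X0 ?Z0 ?mu0.
      rewrite uN pE exprMn -exprM KE !exprD exprS exprVn; field.
      by rewrite l0 X0 ?Z0 ?mu0.
    by rewrite !rpredM ?rpredX.
  case/(prim_sub1_prime wA (Zcyc_conj zm wA)) => H.
    by move: H; congr (_ \in A); rewrite /w exprS; field; rewrite l0 X0 ?Z0 ?mu0.
  have := Zcyc_conj zm H; rewrite rmorphM fmorphV /= conjCK lC => H'.
  have -> : u / (1 - z) ^+ j.+1 = mu * (w / (mu * (1 - z))).
    by rewrite /w exprS; field; rewrite l0 X0 ?Z0 ?mu0.
  exact: rpredM.
have -> : u / p%:R ^+ M = u / (1 - z) ^+ (a * M) * r^-1 ^+ M.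
  rewrite pE exprMn -exprM exprVn; field.
  by rewrite !expf_neq0.
by apply: rpredM; rewrite ?rpredX // div_l.
Qed.

End PrimeAboveP.

(** * Cyclotomic integers of norm 2^t p^M *)

Section NormEquation.

Variables (p c e N t M : nat) (z : algC).
Hypotheses (pp : prime p) (pE : p.+1 = (8 * c)%N) (t0 : (0 < t)%N).
Hypothesis z_prim : (p ^ e.+1).-primitive_root z.
Hypotheses (N_odd : odd N) (pow2N : 2 ^ N = 1 %[mod p ^ e.+1]).
Hypothesis pow2_dvd : forall j, 2 ^ j = 1 %[mod p ^ e.+1] -> (N %| j)%N.
Hypothesis totE : totient (p ^ e.+1) = N.*2.
Variable sg : {rmorphism algC -> algC}.
Hypothesis sgz : sg z = z ^+ 2.

Local Notation A := (Zadj z).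
Local Notation m := (p ^ e.+1)%N.

Definition norm2p (x : algC) := x * x^* = 2 ^+ t * p%:R ^+ M.

Let p3 : (2 < p)%N. Proof. by clear -pE; lia. Qed.
Let p_odd : odd p. Proof. by clear -pE; lia. Qed.
Let m_odd : odd m. Proof. by rewrite oddX p_odd orbT. Qed.
Let m3 : (2 < m)%N.
Proof. by rewrite (leq_trans p3) // expnS leq_pmulr // expn_gt0 prime_gt0. Qed.
Let two0 k : (2 : algC) ^+ k != 0. Proof. by rewrite expf_neq0 ?pnatr_eq0. Qed.
Let pR : p%:R != 0 :> algC. Proof. by rewrite pnatr_eq0 -lt0n prime_gt0. Qed.

Lemma norm2p_neq0 x : norm2p x -> x != 0.
Proof.
move=> xN; apply/eqP => x0; move: xN; rewrite /norm2p x0 mul0r => /esym/eqP.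
by rewrite mulf_eq0 (negPf (two0 _)) expf_eq0 (negPf pR) andbF.
Qed.

(** Only the primes above 2 need comparing: the quotient [u] has norm [p ^+ M.*2], so total
    ramification makes [u / p%:R ^+ M] integral, and it has absolute value 1. *)
Lemma norm2p_associate x y : x \in A -> y \in A -> norm2p x -> norm2p y ->
  y * x^* / 2 ^+ t \in A -> exists k, y = z ^+ k * x \/ y = - z ^+ k * x.
Proof.
move=> xA yA xN yN; set u := y * x^* / 2 ^+ t => uA.
have uN : u * u^* = p%:R ^+ M.*2.
  rewrite /u !rmorphM fmorphV rmorphXn rmorph_nat /= conjCK.
  transitivity ((x * x^*) * (y * y^*) / (2 ^+ t * 2 ^+ t)); first by field.
  by rewrite xN yN -addnn exprD; field.
have vA := Zcyc_norm_ppow_div pp p_odd z_prim uA uN.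
have vN : u / p%:R ^+ M * (u / p%:R ^+ M)^* = 1.
  rewrite rmorphM fmorphV rmorphXn rmorph_nat /= mulrACA uN -addnn exprD -invfM.
  by rewrite divff // mulf_neq0 // expf_neq0.
have [k kE] := Zcyc_unit_norm1 pp p3 z_prim vA vN.
have yE : y = u / p%:R ^+ M * x.
  have xc0 : x^* != 0 by rewrite conjC_eq0 norm2p_neq0.
  apply: (mulIf xc0); rewrite -[RHS]mulrA xN /u; field.
  by rewrite ?two0 ?expf_neq0.
by exists k; case: kE => kE; [left|right]; rewrite yE kE.
Qed.

(** As [m] is odd, this makes [1 - w] invertible modulo 2. *)
Lemma m_div_one_sub w : w ^+ m = 1 -> w != 1 -> m%:R / (1 - w) \in Zadj w.
Proof.
move=> wm w1; have := sum_unity_root wm; rewrite (negPf w1) => S.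
have -> : m%:R = \sum_(k < m) (1 - w ^+ k) :> algC.
  by rewrite sumrB S subr0 sumr_const card_ord.
have w10 : 1 - w != 0 by rewrite subr_eq0 eq_sym.
rewrite mulr_suml rpred_sum // => i _.
have -> : (1 - w ^+ i) / (1 - w) = \sum_(j < i) w ^+ j.
  apply: (mulIf w10); rewrite divfK //.
  by rewrite -opprB subrX1; ring.
by rewrite rpred_sum // => j _; rewrite rpredX ?mem_Zadj.
Qed.

Section Theta.

Variable th : algC.
Hypotheses (th_conj : th^* = 1 - th) (th_mul : th * (1 - th) = 2 * c%:R).
Hypotheses (thA : th \in A) (sg_th : sg th = th).
Hypothesis half_notin : forall b, b \in Zadj th -> norm2p b -> b / 2 \notin Zadj th.

Let tA : 1 - th \in A. Proof. by rewrite rpredB ?rpred1. Qed.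
Let t_conj : (1 - th)^* = th.
Proof. by rewrite rmorphB rmorph1 /= th_conj; ring. Qed.

Lemma theta_idempotent k : ((1 - th) ^+ k.+1 - (1 - th)) / 2 \in A.
Proof.
elim: k => [|k IH]; first by rewrite expr1 subrr mul0r rpred0.
have -> : ((1 - th) ^+ k.+2 - (1 - th)) / 2 =
   (1 - th) * (((1 - th) ^+ k.+1 - (1 - th)) / 2) - (th * (1 - th)) / 2.
  by rewrite (exprS _ k.+1); field.
rewrite th_mul mulrAC divff ?pnatr_eq0 // mul1r.
by apply: rpredB; [exact: rpredM | exact: rpred_nat].
Qed.

Lemma theta_pow_half_notin k n : odd n -> (1 - th) ^+ k.+1 * n%:R / 2 \notin A.
Proof.
move=> on; apply/negP => H.
case/negP: (half_conj_theta z_prim th_conj).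
have nE : n%:R = 1 + 2 * n./2%:R :> algC.
  by rewrite -{1}(odd_double_half n) on natrD -mul2n natrM.
have -> : (1 - th) / 2 = (1 - th) ^+ k.+1 * n%:R / 2 - (1 - th) ^+ k.+1 * n./2%:R
   - ((1 - th) ^+ k.+1 - (1 - th)) / 2 by rewrite nE; field.
apply: rpredB; last exact: theta_idempotent.
by apply: rpredB => //; rewrite rpredM ?rpredX ?rpred_nat.
Qed.

Let pM_odd : odd (p ^ M). Proof. by rewrite oddX p_odd orbT. Qed.

(* [(1 - th) ^+ i * x / 2 ^+ i \in A] says that [(2, th) ^ i] divides [x]. *)
Lemma theta_valuation x : x \in A -> norm2p x -> exists i,
  (1 - th) ^+ i * x / 2 ^+ i \in A /\
  (1 - th) * ((1 - th) ^+ i * x / 2 ^+ i) / 2 \notin A.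
Proof.
move=> xA xN; have xcA := Zcyc_conj z_prim xA.
have bound i : (1 - th) ^+ i * x / 2 ^+ i \in A -> (i <= t)%N.
  move=> iA; rewrite leqNgt; apply/negP => ti.
  have [k iE] : exists k, i = (t + k.+1)%N.
    by exists (i - t).-1; rewrite prednK ?subn_gt0 // subnKC // ltnW.
  case/negP: (theta_pow_half_notin (t + k) pM_odd).
  have -> : (1 - th) ^+ (t + k).+1 * (p ^ M)%:R / 2 =
     (1 - th) ^+ i * x / 2 ^+ i * x^* * 2 ^+ k.
    have -> : (1 - th) ^+ i * x / 2 ^+ i * x^* * 2 ^+ k =
      (1 - th) ^+ i * (x * x^*) / 2 ^+ i * 2 ^+ k by ring.
    by rewrite xN natrX iE -addnS (exprD 2 t) (exprS 2 k); field; rewrite !two0.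
  by rewrite rpredM ?rpredX ?rpred_nat // rpredM.
have ex : exists i, (1 - th) ^+ i * x / 2 ^+ i \in A.
  by exists 0%N; rewrite !expr0 mul1r divr1.
case: (ex_maxnP ex bound) => i iA imax; exists i; split=> //; apply/negP => H.
have /imax : (1 - th) ^+ i.+1 * x / 2 ^+ i.+1 \in A; last by rewrite ltnn.
by move: H; congr (_ \in A); rewrite !exprS; field; rewrite !two0.
Qed.

(** [j] is the valuation of [x^*] at the same prime, hence that of [x] at the conjugate one.
    Primality excludes [i + j < t]; an excess would make an odd multiple of a power of [1 - th]
    divisible by 2. *)
Lemma theta_valuations x : x \in A -> norm2p x -> exists i j,
  [/\ (1 - th) ^+ i * x / 2 ^+ i \in A, th ^+ j * x / 2 ^+ j \in A & (i + j = t)%N].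
Proof.
move=> xA xN; have xcA := Zcyc_conj z_prim xA.
have xcN : norm2p x^* by rewrite /norm2p conjCK mulrC.
have [i [iA iN]] := theta_valuation xA xN.
have [j [jA jN]] := theta_valuation xcA xcN.
exists i, j; split=> //.
  have := Zcyc_conj z_prim jA.
  by rewrite !rmorphM fmorphV !rmorphXn rmorph_nat /= t_conj conjCK.
set x1 := _ / _ in iA iN; set x2 := _ / _ in jA jN.
have x12 : x1 * x2 = (1 - th) ^+ (i + j) * (2 ^+ t * p%:R ^+ M) / 2 ^+ (i + j).
  by rewrite -xN /x1 /x2 !exprD; field; rewrite !two0.
have xxA : x1 * x2 \in A := rpredM iA jA.
case: (ltngtP (i + j) t) => // lt.
  have [k tE] : exists k, t = (i + j + k.+1)%N.
    by exists (t - (i + j)).-1; rewrite prednK ?subn_gt0 // subnKC // ltnW.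
  have : (1 - th) * (x1 * x2) / 2 \in A.
    have -> : (1 - th) * (x1 * x2) / 2 =
       (1 - th) * ((1 - th) ^+ (i + j) * (2 ^+ k * p%:R ^+ M)).
      by rewrite x12 tE (exprD 2 (i + j)) (exprS 2 k); field; rewrite !two0.
    by rewrite !rpredM ?rpredX ?rpred_nat.
  case/(Zcyc_prime_above2 z_prim m_odd m3 N_odd pow2N pow2_dvd totE sgz pp pE
    th_conj th_mul thA sg_th iA jA) => H; [by rewrite H in iN | by rewrite H in jN].
have [k ijE] : exists k, (i + j = t + k.+1)%N.
  by exists (i + j - t).-1; rewrite prednK ?subn_gt0 // subnKC // ltnW.
case/negP: (theta_pow_half_notin (t + k) pM_odd).
have -> : (1 - th) ^+ (t + k).+1 * (p ^ M)%:R / 2 = x1 * x2 * 2 ^+ k.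
  by rewrite x12 ijE natrX -addnS (exprD 2 t) (exprS 2 k); field; rewrite !two0.
by rewrite rpredM ?rpredX ?rpred_nat.
Qed.

Lemma theta_compare x y i j : x \in A -> y \in A -> (i + j = t)%N ->
  (1 - th) ^+ i * x / 2 ^+ i \in A -> th ^+ j * x / 2 ^+ j \in A ->
  (1 - th) ^+ i * y / 2 ^+ i \in A -> th ^+ j * y / 2 ^+ j \in A ->
  y * x^* / 2 ^+ t \in A.
Proof.
move=> xA yA ij /(Zcyc_conj z_prim) xi /(Zcyc_conj z_prim) xj yi yj.
move: xi xj; rewrite !rmorphM !fmorphV !rmorphXn rmorph_nat /= t_conj th_conj.
move=> xi xj; apply: (Zadj_comax_div (th := th) (k := t) (l := t)) => //.
  have -> : th ^+ t * (y * x^*) / 2 ^+ t =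
     (th ^+ j * y / 2 ^+ j) * (th ^+ i * x^* / 2 ^+ i).
    by rewrite -ij !exprD; field; rewrite !two0.
  exact: rpredM.
have -> : (1 - th) ^+ t * (y * x^*) / 2 ^+ t =
   ((1 - th) ^+ i * y / 2 ^+ i) * ((1 - th) ^+ j * x^* / 2 ^+ j).
  by rewrite -ij !exprD; field; rewrite !two0.
exact: rpredM.
Qed.

(* Since [sg z / z = z], dividing [x] by a power of [z] makes it invariant up to
   sign under [sg], and the sign is 1 because [sg] has odd order. *)
Lemma norm2p_fixed x : x \in A -> norm2p x ->
  exists k, sg (x * z^-1 ^+ k) = x * z^-1 ^+ k.
Proof.
move=> xA xN; have sxA := sg_Zcyc sgz xA.
have sxN : norm2p (sg x).
  rewrite /norm2p -(sg_conj z_prim sgz xA) -rmorphM xN.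
  by rewrite rmorphM !rmorphXn !rmorph_nat.
have [i [j [xi xj ij]]] := theta_valuations xA xN.
have yi : (1 - th) ^+ i * sg x / 2 ^+ i \in A.
  have := sg_Zcyc sgz xi.
  by rewrite !rmorphM fmorphV !rmorphXn rmorph_nat rmorphB rmorph1 /= sg_th.
have yj : th ^+ j * sg x / 2 ^+ j \in A.
  have := sg_Zcyc sgz xj.
  by rewrite !rmorphM fmorphV !rmorphXn rmorph_nat /= sg_th.
have [k kE] := norm2p_associate xA sxA xN sxN
  (theta_compare xA sxA ij xi xj yi yj).
exists k; have z0 : z ^+ k != 0 by rewrite expf_neq0 // (prim_root_neq0 z_prim).
set al := x * _.
have alA : al \in A.
  by rewrite rpredM // rpredX // (prim_root_inv z_prim) rpredX ?mem_Zadj.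
have : sg al = al \/ sg al = - al.
  rewrite /al rmorphM rmorphXn fmorphV /= sgz [z^-1 ^+ k]exprVn.
  have -> : (z ^+ 2)^-1 ^+ k = (z ^+ k * z ^+ k)^-1.
    by rewrite exprVn -exprM mul2n -addnn exprD.
  by case: kE => ->; [left|right]; field.
case=> // sal; have itN n : iter n sg al = (-1) ^+ n * al.
  elim: n => [|n IH]; first by rewrite expr0 mul1r.
  by rewrite iterS IH rmorphM rmorphXn rmorphN1 sal exprS; ring.
have := iter_sgN z_prim pow2N sgz alA; rewrite itN -signr_odd N_odd expr1 mulN1r.
by move=> E; rewrite sal E.
Qed.

(** Dividing by the unit [z ^+ k] of [norm2p_fixed] does not affect divisibility by 2 and moves the
    question to Z[th], where [half_notin] answers it. *)
Lemma norm2p_half_notin x : x \in A -> norm2p x -> x / 2 \notin A.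
Proof.
move=> xA xN; have [k sal] := norm2p_fixed xA xN.
have zVA : z^-1 \in A by rewrite (prim_root_inv z_prim) rpredX ?mem_Zadj.
set al := x * _ in sal.
have fix_th w : w \in A -> sg w = w -> w \in Zadj th.
  exact: (Zcyc_fixed z_prim m_odd m3 N_odd pow2N pow2_dvd totE sgz pp pE
    th_conj th_mul thA sg_th).
have alA : al \in A by rewrite rpredM ?rpredX.
have alN : norm2p al.
  have z0 : z ^+ k != 0 by rewrite expf_neq0 // (prim_root_neq0 z_prim).
  rewrite /norm2p -xN /al rmorphM rmorphXn fmorphV /= (prim_root_conj z_prim).
  by rewrite invrK exprVn; field.
apply/negP => x2; case/negP: (half_notin (fix_th _ alA sal) alN); apply: fix_th.
  by rewrite /al mulrAC rpredM ?rpredX.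
by rewrite rmorphM fmorphV rmorph_nat sal.
Qed.

Lemma theta_split_half x i j : (0 < i)%N -> (0 < j)%N ->
  (1 - th) ^+ i * x / 2 ^+ i \in A -> th ^+ j * x / 2 ^+ j \in A -> x / 2 \in A.
Proof.
move=> i0 j0 xi xj; apply: (Zadj_comax_div (th := th) (k := j) (l := i)) => //.
  have -> : th ^+ j * x / 2 = th ^+ j * x / 2 ^+ j * 2 ^+ j.-1.
    by case: (j) j0 => //= j' _; rewrite (exprS 2); field; rewrite !two0.
  by rewrite rpredM ?rpredX ?rpred_nat.
have -> : (1 - th) ^+ i * x / 2 = (1 - th) ^+ i * x / 2 ^+ i * 2 ^+ i.-1.
  by case: (i) i0 => //= i' _; rewrite (exprS 2); field; rewrite !two0.
by rewrite rpredM ?rpredX ?rpred_nat.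
Qed.

Lemma norm2p_dichotomy x : x \in A -> norm2p x ->
  (1 - th) ^+ t * x / 2 ^+ t \in A \/ th ^+ t * x / 2 ^+ t \in A.
Proof.
move=> xA xN; have [i [j [xi xj ij]]] := theta_valuations xA xN.
have [i0|i0] := posnP i; first by right; rewrite -ij i0.
have [j0|j0] := posnP j; first by left; rewrite -ij j0 addn0.
by have := norm2p_half_notin xA xN; rewrite (theta_split_half i0 j0 xi xj).
Qed.

(** The congruence puts [y] on the same side of the dichotomy as [x], so [y] is [z ^+ k * x] up to
    sign. If [z ^+ k] differs from 1, then 2 divides [(1 - z ^+ k) * x], hence [m%:R * x], hence
    [x], which is excluded. *)
Lemma norm2p_congr_theta x y : x \in A -> y \in A -> norm2p x -> norm2p y ->
  (x - y) / 2 \in A -> (1 - th) ^+ t * x / 2 ^+ t \in A -> y = x \/ y = - x.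
Proof.
move=> xA yA xN yN xy xt; have x2 := norm2p_half_notin xA xN.
have yt : (1 - th) ^+ t * y / 2 ^+ t \in A.
  case: (norm2p_dichotomy yA yN) => // yt; case/negP: x2.
  apply: (Zadj_comax_div (th := th) (k := t) (l := t)) => //.
    have -> : th ^+ t * x / 2 = th ^+ t * ((x - y) / 2)
       + th ^+ t * y / 2 ^+ t * 2 ^+ t.-1.
      by case: (t) t0 => //= t' _; rewrite (exprS 2); field; rewrite !two0.
    by apply: rpredD; rewrite rpredM ?rpredX ?rpred_nat.
  have -> : (1 - th) ^+ t * x / 2 = (1 - th) ^+ t * x / 2 ^+ t * 2 ^+ t.-1.
    by case: (t) t0 => //= t' _; rewrite (exprS 2); field; rewrite !two0.
  by rewrite rpredM ?rpredX ?rpred_nat.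
have x0 : th ^+ 0 * x / 2 ^+ 0 \in A by rewrite !expr0 mul1r divr1.
have y0 : th ^+ 0 * y / 2 ^+ 0 \in A by rewrite !expr0 mul1r divr1.
have [k kE] := norm2p_associate xA yA xN yN
  (theta_compare xA yA (addn0 t) xt x0 yt y0).
have zkA : z ^+ k \in A by rewrite rpredX ?mem_Zadj.
have [zk1|zk1] := eqVneq (z ^+ k) 1.
  by case: kE => ->; rewrite zk1 ?mulN1r ?mul1r; [left|right].
have zx : (1 - z ^+ k) * x / 2 \in A.
  case: kE => yE; rewrite yE in xy.
    by move: xy; congr (_ \in A); ring.
  have -> : (1 - z ^+ k) * x / 2 = (x - - z ^+ k * x) / 2 - z ^+ k * x by field.
  by apply: rpredB => //; exact: rpredM.
case/negP: x2.
have zkm : (z ^+ k) ^+ m = 1.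
  by rewrite -exprM mulnC exprM (prim_expr_order z_prim) expr1n.
have mA := Zadj_sub zkA (m_div_one_sub zkm zk1).
have mE : m%:R = 1 + 2 * m./2%:R :> algC.
  by rewrite -{1}(odd_double_half m) m_odd natrD -mul2n natrM.
have -> : x / 2 = (1 - z ^+ k) * x / 2 * (m%:R / (1 - z ^+ k)) - m./2%:R * x.
  by rewrite mE; field; rewrite subr_eq0 eq_sym.
by apply: rpredB; apply: rpredM => //; exact: rpred_nat.
Qed.

(** Multiplying by [x^*] turns the relation into one on the integer [k * p ^ M]. Its divisibility by
    [2 ^+ t] after multiplication by [th ^+ t] follows from [xt], and the conjugate statement is
    then free because the integer is real. *)
Lemma norm2p_int_multiple_theta x S (k : int) : x \in A -> S \in A -> norm2p x ->
  (1 - th) ^+ t * x / 2 ^+ t \in A -> 2 ^+ t * S = k%:~R * x ->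
  exists d : int, S = d%:~R * x.
Proof.
move=> xA SA xN xt Sk.
have Sx : S * x^* = k%:~R * p%:R ^+ M.
  apply: (mulfI (two0 t)); rewrite mulrA Sk -mulrA xN; ring.
have H1 : th ^+ t * (k%:~R * p%:R ^+ M) / 2 ^+ t \in A.
  have := Zcyc_conj z_prim xt.
  rewrite !rmorphM fmorphV !rmorphXn rmorph_nat /= t_conj => xc.
  have -> : th ^+ t * (k%:~R * p%:R ^+ M) / 2 ^+ t = th ^+ t * x^* / 2 ^+ t * S.
    by rewrite -Sx; ring.
  exact: rpredM.
have H2 : (1 - th) ^+ t * (k%:~R * p%:R ^+ M) / 2 ^+ t \in A.
  have := Zcyc_conj z_prim H1.
  by rewrite !rmorphM fmorphV !rmorphXn !rmorph_nat rmorph_int /= th_conj.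
have hQ : k%:~R * p%:R ^+ M / 2 ^+ t \in Crat.
  by rewrite rpred_div ?rpredM ?rpredX ?rpred_int ?rpred_nat.
have /intrP [h hE] := Zcyc_int z_prim (Zadj_comax_div thA H1 H2) hQ.
have kE : k * p%:Z ^+ M = 2 ^+ t * h.
  apply/eqP; rewrite -(eqr_int algC) !rmorphM !rmorphXn /= -hE -pmulrn.
  by apply/eqP; field.
have /dvdzP [d dE] : (2 ^+ t %| k)%Z.
  have : (2 ^+ t %| k * p%:Z ^+ M)%Z by rewrite kE dvdz_mulr.
  rewrite Gauss_dvdzl // coprimezE !abszX /=.
  by rewrite coprimeXl // coprimeXr // coprime2n.
exists d; apply: (mulfI (two0 t)); rewrite Sk dE rmorphM rmorphXn /=; ring.
Qed.

End Theta.

Variable th : algC.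
Hypotheses (th_conj : th^* = 1 - th) (th_mul : th * (1 - th) = 2 * c%:R).
Hypotheses (thA : th \in A) (sg_th : sg th = th).
Hypothesis half_notin : forall b, b \in Zadj th -> norm2p b -> b / 2 \notin Zadj th.

(** Replacing [th] by [1 - th] exchanges the two primes above 2 and reduces the second case of
    [norm2p_dichotomy] to the first. *)
Let th' := 1 - th.
Let th'K : 1 - th' = th. Proof. by rewrite /th'; ring. Qed.
Let th'_conj : th'^* = 1 - th'.
Proof. by rewrite th'K /th' rmorphB rmorph1 /= th_conj; ring. Qed.
Let th'_mul : th' * (1 - th') = 2 * c%:R. Proof. by rewrite th'K mulrC. Qed.
Let th'A : th' \in A. Proof. by rewrite /th' rpredB ?rpred1. Qed.
Let sg_th' : sg th' = th'. Proof. by rewrite /th' rmorphB rmorph1 sg_th. Qed.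
Let half_notin' b : b \in Zadj th' -> norm2p b -> b / 2 \notin Zadj th'.
Proof.
have sub1 : {subset Zadj th' <= Zadj th}.
  by apply: Zadj_sub; rewrite rpredB ?rpred1 ?mem_Zadj.
have sub2 : {subset Zadj th <= Zadj th'}.
  by apply: Zadj_sub; rewrite -th'K rpredB ?rpred1 ?mem_Zadj.
move=> /sub1 bA bN; apply/negP => /sub1; apply/negP; exact: half_notin.
Qed.

Lemma norm2p_congr x y : x \in A -> y \in A -> norm2p x -> norm2p y ->
  (x - y) / 2 \in A -> y = x \/ y = - x.
Proof.
move=> xA yA xN yN xy.
case: (norm2p_dichotomy th_conj th_mul thA sg_th half_notin xA xN) => xt.
  exact: (norm2p_congr_theta th_conj th_mul thA sg_th half_notin xA yA xN yN xy).
apply: (norm2p_congr_theta th'_conj th'_mul th'A sg_th' half_notin' xA yA xN yN xy).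
by rewrite th'K.
Qed.

Lemma norm2p_int_multiple x S (k : int) : x \in A -> S \in A -> norm2p x ->
  2 ^+ t * S = k%:~R * x -> exists d : int, S = d%:~R * x.
Proof.
move=> xA SA xN Sk.
case: (norm2p_dichotomy th_conj th_mul thA sg_th half_notin xA xN) => xt.
  exact: (norm2p_int_multiple_theta th_conj thA xA SA xN xt Sk).
apply: (norm2p_int_multiple_theta th'_conj th'A xA SA xN _ Sk).
by rewrite th'K.
Qed.

End NormEquation.

(** * Characters and generalized bent functions *)

Section Character.

Variables (C : numClosedFieldType) (q : nat) (w : C).
Hypotheses (q1 : (1 < q)%N) (wq : q.-primitive_root w).

Definition chi (a : 'Z_q) : C := w ^+ a.

Let w1 : w ^+ (Zp_trunc q).+2 = 1.
Proof. by rewrite Zp_cast // (prim_expr_order wq). Qed.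

Lemma chi0 : chi 0 = 1. Proof. by rewrite /chi expr0. Qed.

Lemma chiD a b : chi (a + b) = chi a * chi b.
Proof. by rewrite /chi /= (expr_mod _ w1) exprD. Qed.

Lemma chiN a : chi (- a) = (chi a)^-1.
Proof.
have /eqP E : chi (- a) * chi a = 1 by rewrite -chiD addNr chi0.
have a0 : chi a != 0.
  by apply/negP => /eqP a0; move: E; rewrite a0 mulr0 eq_sym oner_eq0.
by apply: (mulIf a0); rewrite (eqP E) mulVf.
Qed.

Lemma chi_conj a : (chi a)^* = chi (- a).
Proof.
rewrite chiN (@conj_unity_root _ q) ?(ltnW q1) //.
by rewrite /chi -exprM mulnC exprM (prim_expr_order wq) expr1n.
Qed.

Lemma chiMn a k : chi (a *+ k) = chi a ^+ k.
Proof. by elim: k => [|k IH]; rewrite ?chi0 // mulrS chiD IH exprS. Qed.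

Lemma chiM a b : chi (a * b) = chi a ^+ b.
Proof. by rewrite -{1}(natr_Zp b) mulr_natr chiMn. Qed.

Lemma chi_eq1 a : (chi a == 1) = (a == 0).
Proof.
rewrite /chi -(prim_order_dvd wq) -val_eqE /=.
have aq : (a < q)%N by rewrite -[X in (_ < X)%N](Zp_cast q1).
by rewrite /dvdn modn_small.
Qed.

Lemma chi_sum I (r : seq I) (P : pred I) (F : I -> 'Z_q) :
  chi (\sum_(i <- r | P i) F i) = \prod_(i <- r | P i) chi (F i).
Proof. exact: (big_morph chi chiD chi0). Qed.

Lemma sum_chi a : \sum_(b : 'Z_q) chi (a * b) = if a == 0 then q%:R else 0.
Proof.
under eq_bigr do rewrite chiM.
rewrite sum_unity_root; first by rewrite chi_eq1; case: eqP => // _; rewrite Zp_cast.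
by rewrite /chi -exprM mulnC exprM w1 expr1n.
Qed.

Variable n : nat.
Implicit Types x y l : {ffun 'I_n -> 'Z_q}.

Lemma dotZDr x l l' : dotZ x (l + l' : {ffun 'I_n -> 'Z_q}) = dotZ x l + dotZ x l'.
Proof. by rewrite /dotZ -big_split; apply: eq_bigr => i _; rewrite ffunE mulrDr. Qed.

Lemma dotZBl x y l : dotZ (x - y : {ffun 'I_n -> 'Z_q}) l = dotZ x l - dotZ y l.
Proof.
rewrite /dotZ -sumrB; apply: eq_bigr => i _.
by rewrite !ffunE mulrDl mulNr.
Qed.

Lemma sum_chi_dot x :
  \sum_(l : {ffun 'I_n -> 'Z_q}) chi (dotZ x l) = if x == 0 then (q ^ n)%:R else 0.
Proof.
transitivity (\prod_(i < n) \sum_(b : 'Z_q) chi (x i * b)).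
  rewrite bigA_distr_bigA; apply: eq_bigr => l _ /=.
  by rewrite /dotZ chi_sum.
under eq_bigr do rewrite sum_chi.
case: eqP => [->|/eqP x0].
  under eq_bigr do rewrite ffunE eqxx.
  by rewrite prodr_const card_ord natrX.
have [i xi] : exists i, x i != 0.
  apply/existsP; apply: contraNT x0; rewrite negb_exists => /forallP x0.
  by apply/eqP/ffunP => i; rewrite ffunE; apply/eqP; have := x0 i; rewrite negbK.
by rewrite (bigD1 i) //= (negPf xi) mul0r.
Qed.

Variable f : {ffun 'I_n -> 'Z_q} -> 'Z_q.

Definition gbf_sum l : C := \sum_x chi (f x - dotZ x l).

(** One integer polynomial gives the squared modulus at every primitive [q]-th root of unity; this
    lets the GBF equation pass from [R[i]] to [algC]. *)
Definition gbf_norm_poly l : {poly int} :=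
  \sum_x \sum_y 'X^(nat_of_ord (f x - dotZ x l - (f y - dotZ y l))%R).

Lemma gbf_norm_polyE l :
  gbf_sum l * (gbf_sum l)^* = (map_poly intr (gbf_norm_poly l)).[w].
Proof.
rewrite /gbf_sum rmorph_sum big_distrlr /= /gbf_norm_poly rmorph_sum horner_sum.
apply: eq_bigr => x _; rewrite rmorph_sum horner_sum; apply: eq_bigr => y _ /=.
by rewrite map_polyXn hornerXn chi_conj -chiD.
Qed.

End Character.

Lemma is_gbf_norm (R : realType) q n (f : {ffun 'I_n -> 'Z_q} -> 'Z_q) (w : algC) l :
  (1 < q)%N -> q.-primitive_root w -> is_gbf R f ->
  gbf_sum w f l * (gbf_sum w f l)^* = (q ^ n)%:R.
Proof.
move=> q1 wq fG; have zq := zeta_prim R q1.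
have GE : gbf_transform R f l = gbf_sum (zeta R q) f l.
  apply: eq_bigr => x _; rewrite (chiD q1 zq) (chiN q1 zq) /chi.
  by rewrite exprVn.
have := fG l; rewrite GE (gbf_norm_polyE q1 zq) => E.
rewrite (gbf_norm_polyE q1 wq); apply/eqP.
pose P : {poly int} := gbf_norm_poly f l - (q ^ n)%:R%:P.
have PE (C : numClosedFieldType) (y : C) : (map_poly intr P).[y] =
    (map_poly intr (gbf_norm_poly f l)).[y] - (q ^ n)%:R.
  by rewrite rmorphB /= map_polyC !hornerE /= rmorph_nat.
rewrite -subr_eq0 -PE -rootE; apply: (prim_root_transfer zq wq).
by rewrite rootE PE E subrr.
Qed.

Lemma card_even_ord N k : N = k.*2 -> #|[pred a : 'I_N | ~~ odd a]| = k.
Proof.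
move=> ->; rewrite -sum1_card big_mkcond /=; elim: k => [|k IH].
  by rewrite big_ord0.
rewrite doubleS !big_ord_recr /= !inE /= odd_double /= addn0 addn1; congr _.+1.
exact: IH.
Qed.

(** * The parity argument on partial sums over even vectors *)

Section Counting.

Variables (q m n : nat) (w : algC).
Hypotheses (qE : q = (2 * m)%N) (m_odd : odd m) (m1 : (1 < m)%N) (n0 : (0 < n)%N).
Hypothesis wq : q.-primitive_root w.
Variable f : {ffun 'I_n -> 'Z_q} -> 'Z_q.

Implicit Types x y l : {ffun 'I_n -> 'Z_q}.

Local Notation A := (Zadj (- w)).
Local Notation F := (gbf_sum w f).
Local Notation ch := (@chi algC q w).

Hypothesis F_norm : forall l, F l * (F l)^* = (q ^ n)%:R.
Hypothesis F_congr : forall l l', (F l - F l') / 2 \in A ->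
  F l' = F l \/ F l' = - F l.
Hypothesis F_int : forall l S (k : int), S \in A -> 2 ^+ n * S = k%:~R * F l ->
  exists d : int, S = d%:~R * F l.

Let q1 : (1 < q)%N. Proof. by rewrite qE; clear - m1; lia. Qed.

Lemma prim_root_pow_half : w ^+ m = -1.
Proof.
have : (w ^+ m) ^+ 2 == 1.
  by rewrite -exprM mulnC -qE (prim_expr_order wq).
rewrite sqrf_eq1 => /orP [|/eqP //]; rewrite -(prim_order_dvd wq) => /dvdn_leq.
by rewrite qE; clear - m1; lia.
Qed.

Lemma chi_Zadj a : ch a \in A.
Proof.
by rewrite /chi rpredX // -[X in X \in _]opprK rpredN mem_Zadj.
Qed.

Definition shift (v : {ffun 'I_n -> bool}) : {ffun 'I_n -> 'Z_q} :=
  [ffun i => if v i then m%:R else 0].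

Lemma natm2 : m%:R + m%:R = 0 :> 'Z_q.
Proof. by rewrite -natrD addnn -mul2n -qE pchar_Zp. Qed.

Lemma chi_natm (a : 'Z_q) : ch (a * m%:R) = (-1) ^+ a.
Proof. by rewrite mulr_natr (chiMn q1 wq) -exprM mulnC exprM prim_root_pow_half. Qed.

Lemma chi_dot_shift x v :
  ch (dotZ x (shift v)) = \prod_(i < n) (if v i then (-1) ^+ (x i : nat) else 1).
Proof.
rewrite /dotZ (chi_sum q1 wq); apply: eq_bigr => i _; rewrite ffunE.
by case: (v i); rewrite ?chi_natm // mulr0 chi0.
Qed.

Lemma chi_dot_shift_sq x v :
  ch (dotZ x (shift v)) = 1 \/ ch (dotZ x (shift v)) = -1.
Proof.
suff : ch (dotZ x (shift v)) ^+ 2 == 1.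
  by rewrite sqrf_eq1 => /orP [] /eqP; auto.
have <- : ch (dotZ x (shift v + shift v : {ffun 'I_n -> 'Z_q})) = ch (dotZ x (shift v)) ^+ 2.
  by rewrite dotZDr (chiD q1 wq) expr2.
have -> : shift v + shift v = 0.
  by apply/ffunP => i; rewrite !ffunE; case: (v i); rewrite ?natm2 ?addr0.
by rewrite /dotZ big1 ?chi0 // => i _; rewrite ffunE mulr0.
Qed.

Lemma gbf_sum_shift l v : F (l + shift v) =
  \sum_x ch (f x - dotZ x l) * ch (dotZ x (shift v)).
Proof.
apply: eq_bigr => x _; rewrite dotZDr opprD addrA (chiD q1 wq); congr (_ * _).
by rewrite (chiN q1 wq); case: (chi_dot_shift_sq x v) => ->; rewrite ?invrN invr1.
Qed.

Definition evenx : pred {ffun 'I_n -> 'Z_q} :=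
  fun x => [forall i, ~~ odd (x i)].

Definition even_sum l : algC := \sum_(x | evenx x) ch (f x - dotZ x l).

Lemma even_chi_shift x v : evenx x -> ch (dotZ x (shift v)) = 1.
Proof.
move/forallP => xe; rewrite chi_dot_shift big1 // => i _.
by case: (v i); rewrite // -signr_odd (negPf (xe i)).
Qed.

(** For each [x] the sum over [v] factors as the product over [i] of [1 + (-1) ^+ x i], which is
    [2 ^+ n] or 0. *)
Lemma sum_shift l : \sum_v F (l + shift v) = 2 ^+ n * even_sum l.
Proof.
under eq_bigr do rewrite gbf_sum_shift.
rewrite exchange_big /= mulr_sumr [RHS]big_mkcond /=; apply: eq_bigr => x _.
rewrite -mulr_sumr; under eq_bigr do rewrite chi_dot_shift.
have -> : \sum_(v : {ffun 'I_n -> bool})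
     \prod_(i < n) (if v i then (-1) ^+ (x i : nat) else 1) =
   \prod_(i < n) \sum_(b : bool) (if b then (-1) ^+ (x i : nat) else 1 : algC).
  by rewrite bigA_distr_bigA.
under eq_bigr do rewrite big_bool /=.
case: ifP => [/forallP xe|/negP ne].
  rewrite (eq_bigr (fun=> 2)) => [|i _]; last by rewrite -signr_odd (negPf (xe i)) expr0; ring.
  by rewrite prodr_const card_ord mulrC.
have [i xi] : exists i, odd (x i).
  apply: contrapT => no; apply: ne; apply/forallP => i.
  by apply/negP => xi; apply: no; exists i.
by rewrite (bigD1 i) //= -signr_odd xi expr1 addNr mul0r mulr0.
Qed.

Lemma even_sum_multiple l : exists d : int, even_sum l = d%:~R * F l.
Proof.
have /boolp.choice [ep epE] : forall v, exists ep : int, F (l + shift v) = ep%:~R * F l.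
  move=> v; have : (F l - F (l + shift v)) / 2 \in A.
    rewrite gbf_sum_shift /gbf_sum -sumrB mulr_suml rpred_sum // => x _.
    have cA := chi_Zadj (f x - dotZ x l).
    case: (chi_dot_shift_sq x v) => ->; first by rewrite mulr1 subrr mul0r rpred0.
    by move: cA; congr (_ \in A); field.
  by case/F_congr => ->; [exists 1 | exists (-1)]; rewrite ?mul1r // rmorphN1 mulN1r.
apply: (F_int (k := \sum_v ep v)).
  by rewrite rpred_sum // => x _; exact: chi_Zadj.
rewrite -sum_shift rmorph_sum mulr_suml; apply: eq_bigr => v _; exact: epE.
Qed.

Lemma sum_even_norm :
  \sum_l even_sum l * (even_sum l)^* = (q ^ n)%:R * #|evenx|%:R.
Proof.
transitivity (\sum_(x | evenx x) \sum_(y | evenx y)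
    \sum_(l : {ffun 'I_n -> 'Z_q}) ch (f x - f y) * ch (dotZ (y - x : {ffun 'I_n -> 'Z_q}) l)).
  under [RHS]eq_bigr do rewrite exchange_big.
  rewrite [RHS]exchange_big; apply: eq_bigr => l _ /=.
  rewrite rmorph_sum big_distrlr /=; apply: eq_bigr => x _; apply: eq_bigr => y _.
  rewrite (chi_conj q1 wq) -!(chiD q1 wq); congr (ch _); rewrite dotZBl.
  by ring.
transitivity (\sum_(x | evenx x) (q ^ n)%:R : algC).
  apply: eq_bigr => x ex; rewrite (bigD1 x) //= [X in _ + X]big1 => [|y /andP [_ yx]].
    by rewrite -mulr_sumr (sum_chi_dot q1 wq) !subrr eqxx chi0 mul1r addr0.
  by rewrite -mulr_sumr (sum_chi_dot q1 wq) subr_eq0 (negPf yx) mulr0.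
by rewrite sumr_const mulr_natr.
Qed.

Lemma odd_card_evenx : odd #|evenx|.
Proof.
have -> : #|evenx| = #|ffun_on [pred a : 'Z_q | ~~ odd a] : {pred {ffun 'I_n -> 'Z_q}}|.
  by apply: eq_card => x; apply/forallP/ffun_onP.
rewrite card_ffun_on oddX; apply/orP; right.
by rewrite (@card_even_ord _ m) // Zp_cast // qE mul2n.
Qed.

Lemma counting_contradiction : False.
Proof.
have /boolp.choice [d dE] := even_sum_multiple.
have qn0 : (q ^ n)%:R != 0 :> algC by rewrite pnatr_eq0 expn_eq0 negb_and -lt0n ltnW.
have normE l : even_sum l * (even_sum l)^* = (q ^ n)%:R * (d l ^+ 2)%:~R.
  rewrite dE rmorphM rmorph_int /= -(F_norm l) rmorphXn /=; ring.
have cardE : \sum_l d l ^+ 2 = #|evenx|%:Z.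
  apply/eqP; rewrite -(eqr_int algC) rmorph_sum -pmulrn; apply/eqP.
  apply: (mulfI qn0); rewrite -sum_even_norm mulr_sumr.
  by apply: eq_bigr => l _; rewrite normE.
pose e := shift [ffun=> true].
(* [even_sum] is invariant under [e], but [F] may change sign; comparing squared moduli, with that
   of [F] constant, only determines [d] up to sign. *)
have de l : d (l + e) ^+ 2 = d l ^+ 2.
  apply/eqP; rewrite -(eqr_int algC); apply/eqP; apply: (mulfI qn0).
  rewrite -!normE; suff -> : even_sum (l + e) = even_sum l by [].
  apply: eq_bigr => x ex; rewrite dotZDr opprD addrA (chiD q1 wq) (chiN q1 wq).
  by rewrite even_chi_shift // invr1 mulr1.
(* Adding [m] modulo [2 * m] exchanges the lower and upper half of the residues, so [low] selects
   one vector from each pair [l], [l + e]. Here [0 < n] is used. *)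
pose i0 := Ordinal n0; pose low (l : {ffun 'I_n -> 'Z_q}) := (l i0 < m)%N.
have lowe l : low (l + e) = ~~ low l.
  have valD (a b : 'Z_q) : (a + b)%R = ((a + b) %% q)%N :> nat.
    by rewrite /=; congr modn; exact: Zp_cast.
  have aq : (l i0 < q)%N by rewrite -[X in (_ < X)%N](Zp_cast q1).
  have mq : (m < q)%N by rewrite qE; clear - m1; lia.
  rewrite /low ffunE valD !ffunE val_Zp_nat // (modn_small mq).
  move: (nat_of_ord (l i0)) aq => a; rewrite qE => aq; rewrite -leqNgt.
  have [ma|am] := leqP m a.
    have -> : (a + m = 2 * m + (a - m))%N by clear - ma; lia.
    by rewrite modnDl modn_small; clear - ma aq; lia.
  by rewrite modn_small; clear - am; lia.
have : #|evenx|%:Z = 2 * \sum_(l | low l) d l ^+ 2.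
  rewrite -cardE (bigID low) /= [X in _ + X](reindex_inj (addIr e)) /=.
  rewrite [X in _ + X](eq_big low (fun l => d l ^+ 2)) => [|l|l _].
  - by ring.
  - by rewrite lowe negbK.
  - exact: de.
by move/(congr1 absz); rewrite abszM => /(congr1 odd); rewrite odd_card_evenx oddM.
Qed.

End Counting.

(** * Putting the pieces together for q = 2 p^e *)

Lemma prim_root_opp m (w : algC) : odd m -> (1 < m)%N ->
  (2 * m).-primitive_root w -> m.-primitive_root (- w).
Proof.
(* Since [w ^+ m = -1], the root [- w] is [w ^+ m.+1], and the gcd of [m.+1] with [2 * m] is 2. *)
move=> om m1 wq; have := exp_prim_root wq m.+1.
rewrite exprSr (prim_root_pow_half (erefl _) m1 wq) mulN1r.
have -> : gcdn m.+1 (2 * m) = 2.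
  rewrite mulnC Gauss_gcdr ?coprimeSn //.
  by apply/gcdn_idPr; rewrite dvdn2 /= om.
by rewrite mulKn.
Qed.

(** [omega p] is, up to sign and an integer, the Gauss period of a primitive [p]-th root that is a
    power of [z]; squaring [z] only permutes the terms of the period. *)
Lemma omega_Zcyc p c f e (z : algC) (sg : {rmorphism algC -> algC}) :
  prime p -> p.+1 = (8 * c)%N -> p = f.*2.+1 -> odd f -> is_mul_order 2 p f ->
  (p ^ e.+1).-primitive_root z -> sg z = z ^+ 2 ->
  omega p \in Zadj z /\ sg (omega p) = omega p.
Proof.
move=> pp pE fE f_odd ord zm sgz; have [f0 [pow2f _]] := ord.
have pow2_dvd j : 2 ^ j = 1 %[mod p] -> (f %| j)%N by apply: mul_order_dvd.
have yp : p.-primitive_root (z ^+ (p ^ e)).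
  have := dvdn_prim_root zm (dvdn_exp (ltn0Sn e) (dvdnn p)).
  by rewrite expnS mulKn // prime_gt0.
have := omega_period pE fE f_odd pow2f pow2_dvd yp (omega_conj_mul pE).
set s := gauss_period _ _ => thE.
have sA : s \in Zadj z by rewrite rpred_sum // => k _; rewrite !rpredX ?mem_Zadj.
have ss : sg s = s.
  rewrite -[RHS](period_sq f_odd pow2f (prim_expr_order yp)) /s rmorph_sum.
  by apply: eq_bigr => k _; rewrite !rmorphXn /= sgz -!exprM; congr (z ^+ _); ring.
case: thE => ->; first by rewrite rpredN rmorphN ss.
by rewrite rpredD ?rpred1 // rmorphD rmorph1 ss.
Qed.

Lemma no_gbf (R : realType) p P t e q : prime p -> (p %% 8 = 7)%N ->
  is_mul_order 2 p (p.-1 %/ 2) -> prime_ideal p P -> P 2 -> is_class_order p P t ->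
  e = 0%N \/ 2 ^ p.-1 <> 1 %[mod p ^ 2] -> q = (2 * p ^ e.+1)%N ->
  forall f : {ffun 'I_t -> 'Z_q} -> 'Z_q, ~ is_gbf R f.
Proof.
move=> pp p8 ord Ppr P2 cls nw qE f fG.
have [c pE] : exists c, p.+1 = (8 * c)%N by exists (p.+1 %/ 8)%N; clear - p8; lia.
set h := (p.-1 %/ 2)%N in ord.
have hE : p = h.*2.+1 by rewrite /h; clear - pE; lia.
have h_odd : odd h by clear - pE hE; lia.
have p3 : (2 < p)%N by clear - pE; lia.
have p_odd : odd p by rewrite hE /= odd_double.
set m := (p ^ e.+1)%N in qE.
have m_odd : odd m by rewrite oddX p_odd orbT.
have m3 : (2 < m)%N by rewrite (leq_trans p3) // /m expnS leq_pmulr // expn_gt0 prime_gt0.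
have nw' : e.+1 = 1%N \/ 2 ^ (h * 2) <> 1 %[mod p ^ 2].
  case: nw => [->|nw]; [by left | right]; have -> : (h * 2 = p.-1)%N by rewrite hE muln2.
  exact: nw.
have [pow2N pow2_dvd] := order2_ppow pp p3 ord (ltn0Sn e) nw'.
set N := (p ^ e.+1.-1 * h)%N in pow2N pow2_dvd.
have N_odd : odd N by rewrite oddM oddX p_odd orbT.
have totE : totient m = N.*2.
  by rewrite totient_pfactor // /N -muln2 {1}hE /= -muln2; ring.
have q1 : (1 < q)%N by rewrite qE; clear - m3; lia.
have [w wq] := C_prim_root_exists (ltnW q1).
have m1 : (1 < m)%N := ltnW m3.
have zm : m.-primitive_root (- w) by apply: prim_root_opp => //; rewrite -qE.
have [sg sgE] : {sg : {rmorphism algC -> algC} |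
    forall z, z ^+ m = 1 -> sg z = z ^+ 2}.
  by apply: Qn_aut_exists; rewrite coprime2n.
have sgz := sgE _ (prim_expr_order zm).
have [thA sg_th] := omega_Zcyc pp pE hE h_odd ord zm sgz.
(* The exponent of [p] in [q ^ t]; the exponent of 2 is [t] itself. *)
pose M := (e.+1 * t)%N; have t0 : (0 < t)%N by case: cls.
have half b : b \in Zadj (omega p) -> norm2p p t M b -> b / 2 \notin Zadj (omega p).
  exact: (norm_half_notin pE (omega_conj p) (omega_conj_mul pE) (erefl _) Ppr P2 pp cls).
have FA l : gbf_sum w f l \in Zadj (- w).
  by rewrite rpred_sum // => x _; exact: chi_Zadj.
have FN l : gbf_sum w f l * (gbf_sum w f l)^* = (q ^ t)%:R.
  exact: is_gbf_norm fG.
have F2 l : norm2p p t M (gbf_sum w f l).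
  by rewrite /norm2p FN qE expnMn natrM !natrX /M exprM.
apply: (counting_contradiction qE m_odd m1 t0 wq FN) => [l l'|l S k SA].
  exact: (norm2p_congr pp pE t0 zm N_odd pow2N pow2_dvd totE sgz (omega_conj p)
    (omega_conj_mul pE) thA sg_th half).
exact: (norm2p_int_multiple pp pE zm N_odd pow2N pow2_dvd totE sgz (omega_conj p)
  (omega_conj_mul pE) thA sg_th half).
Qed.

Local Close Scope ring_scope.

Theorem theorem1 (R : realType) (p : nat) (P : algC -> Prop) (tp : nat) :
  prime p -> p %% 8 = 7 ->
  is_mul_order 2 p (p.-1 %/ 2) ->
  prime_ideal p P -> P (2%:R)%R -> is_class_order p P tp ->
  (forall f : {ffun 'I_tp -> 'Z_(2 * p)} -> 'Z_(2 * p), ~ is_gbf R f) /\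
  (2 ^ p.-1 <> 1 %[mod p ^ 2] ->
   forall e : nat, (1 <= e)%N ->
     forall f : {ffun 'I_tp -> 'Z_(2 * p ^ e)} -> 'Z_(2 * p ^ e), ~ is_gbf R f).
Proof.
move=> pp p8 ord Ppr P2 cls; split.
  by apply: (no_gbf pp p8 ord Ppr P2 cls (or_introl (erefl 0%N))); rewrite expn1.
by move=> nw [//|e] _; apply: (no_gbf pp p8 ord Ppr P2 cls (or_intror nw)).
Qed.
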